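(* Consider the single-server retrial queue with event-dependent arrivals described in the context, and let $X_i$ be the number of customers in orbit just after the $i$-th departure, $i\ge 1$. Then the Markov chain $\{X_i, i\ge 1\}$ is ergodic if and only if $$\bar b<\frac{\alpha^{*}(\lambda^{-})\,[\lambda_{+}^{r}+(\lambda^{r}-\lambda_{+}^{r})\beta^{*}(\lambda^{r})]}{\lambda^{r}[\lambda_{+}^{e}+(\lambda_{+}^{r}-\lambda_{+}^{e})\alpha^{*}(\lambda^{-})]}-\frac{(1-\alpha^{*}(\lambda^{-}))(\lambda^{e}-\lambda_{+}^{e})(1-\beta^{*}(\lambda^{e}))}{\lambda^{e}[\lambda_{+}^{e}+(\lambda_{+}^{r}-\lambda_{+}^{e})\alpha^{*}(\lambda^{-})]}.$$
   Context: Model. A single server with no waiting room and an infinite-capacity orbit. Service times are i.i.d. with density $b(\cdot)$, Laplace-Stieltjes transform (LST) $\beta^{*}(s)=\int_0^\infty e^{-st}b(t)\,dt$ and finite mean $\bar b$. A customer arriving at a busy server joins the orbit. After each service completion the customer leaves and, if the orbit is nonempty, the server starts seeking a customer from the orbit; seeking times are i.i.d. with density $a(\cdot)$ and LST $\alpha^{*}(s)=\int_0^\infty e^{-st}a(t)\,dt$. If an external (primary) customer arrives during seeking, the seeking is cancelled and the arriving customer is served; otherwise at the end of the seeking time one orbiting (retrial) customer leaves the orbit and starts service. If the orbit is empty, the server waits for an external arrival. Interarrival, service and seeking times are mutually independent. Event-dependent arrival rates (all positive): while the server is idle (the last event was a service completion), external customers arrive at rate $\lambda^{-}$. During a service of an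 external customer (type $e$) the first arrival occurs at rate $\lambda^{e}$ and all subsequent arrivals during that service at rate $\lambda_{+}^{e}$. During a service of a retrial customer (type $r$) the first arrival occurs at rate $\lambda^{r}$ and all subsequent arrivals during that service at rate $\lambda_{+}^{r}$. (All interarrival times are exponential with these rates.) For $k\in\{e,r\}$ let $b_n^{k}$ be the probability that exactly $n$ customers arrive during a service of a type-$k$ customer, i.e. $b_n^k=\int_0^\infty \mathbb P_k(N(t)=n)b(t)\,dt$, where under $\mathbb P_k$ the counting process $N$ is the pure birth process started at $0$ with birth rate $\lambda^k$ in state $0$ and $\lambda_+^k$ in every state $n\ge1$. The chain $\{X_i\}$ on $\{0,1,2,\dots\}$ has one-step transition probabilities $p_{0,n}=b_n^{e}$ for $n\ge0$; $p_{m,n}=(1-\alpha^{*}(\lambda^{-}))b_{n-m}^{e}+\alpha^{*}(\lambda^{-})b_{n-m+1}^{r}$ for $1\le m\le n$; $p_{m+1,m}=\alpha^{*}(\lambda^{-})b_0^{r}$ for $m\ge0$; and all others are $0$. Ergodic means irreducible, aperiodic and positive recurrent. *)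

(* Defs.v *)
From HB Require Import structures.
From mathcomp Require Import all_boot all_order all_algebra.
From mathcomp Require Import all_classical all_reals all_analysis.

Set Implicit Arguments.
Unset Strict Implicit.
Unset Printing Implicit Defensive.

Import Order.TTheory GRing.Theory Num.Theory.
Import numFieldNormedType.Exports.

Local Open Scope classical_set_scope.
Local Open Scope ring_scope.

Definition is_density (R : realType) (f : R -> R) : Prop :=
  [/\ measurable_fun (`[0, +oo[ : set R) f,
      forall t, 0 <= t -> 0 <= f t &
      (\int[lebesgue_measure]_(t in `[0%R, +oo[) (f t)%:E = 1)%E].

(* Extended-valued, so that finiteness of the mean can be a hypothesis. *)
Definition mean (R : realType) (f : R -> R) : \bar R :=
  (\int[lebesgue_measure]_(t in `[0%R, +oo[) (t * f t)%:E)%E.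

Definition LST (R : realType) (f : R -> R) (s : R) : R :=
  \int[lebesgue_measure]_(t in `[0, +oo[) (expR (- s * t) * f t).

Definition mutually_independent (d : measure_display) (T : measurableType d)
    (R : realType) (P : probability T R) (X : nat -> {RV P >-> R}) : Prop :=
  forall (J : seq nat) (A : nat -> set R),
    uniq J -> (forall j, measurable (A j)) ->
    P (\bigcap_(j in [set` J]) (X j @^-1` A j)) =
    (\prod_(j <- J) P (X j @^-1` A j))%E.

Definition birth_rate (R : realType) (first next : R) (n : nat) : R :=
  if n is 0%N then first else next.

(* [tau n] is the sojourn time in state n of the pure birth process which is
   started at 0 and has birth rate [rate n] in state n. *)
Definition birth_process_times (d : measure_display) (T : measurableType d)
    (R : realType) (P : probability T R) (rate : nat -> R)
    (tau : nat -> {RV P >-> R}) : Prop :=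
  mutually_independent tau /\
  forall n (A : set R), measurable A ->
    distribution P (tau n) A = exponential_prob (rate n) A.

Definition birth_epoch (d : measure_display) (T : measurableType d)
    (R : realType) (P : probability T R) (tau : nat -> {RV P >-> R})
    (n : nat) (w : T) : R :=
  \sum_(i < n) tau i w.

(* The event N(t) = n: the n-th birth, but not the next one, has occurred by
   time t. *)
Definition births_eq (d : measure_display) (T : measurableType d)
    (R : realType) (P : probability T R) (tau : nat -> {RV P >-> R})
    (t : R) (n : nat) : set T :=
  [set w | birth_epoch tau n w <= t < birth_epoch tau n.+1 w].

(* The probability of n births during an independent time of density b. *)
Definition arrivals_prob (d : measure_display) (T : measurableType d)
    (R : realType) (P : probability T R) (tau : nat -> {RV P >-> R})
    (b : R -> R) (n : nat) : R :=
  \int[lebesgue_measure]_(t in `[0, +oo[) (fine (P (births_eq tau t n)) * b t).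

(* In the use below, al is the probability that the seeking time ends before
   the next external arrival, and be, br are the laws of the number of
   arrivals during the service of an external, resp. retrial, customer. *)
Definition orbit_chain (R : realType) (al : R) (be br : nat -> R)
    (m n : nat) : R :=
  if m == 0%N then be n
  else if (m <= n)%N then
    (1 - al) * be (n - m)%N + al * br (n - m + 1)%N
  else if m == n.+1 then al * br 0%N
  else 0.

(* Markov chains on nat with one-step transition probabilities p. The series
   are taken in \bar R, where they are meaningful because p is nonnegative. *)

Fixpoint step_prob (R : realType) (p : nat -> nat -> R) (k i j : nat) : \bar R :=
  if k is k'.+1 then
    (\sum_(0 <= l <oo) (p i l)%:E * step_prob p k' l j)%E
  else ((i == j)%:R)%:E.

(* The probability that, from i, the first visit to j at a time >= 1 takes
   place at time k; it is 0 for k = 0. *)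
Fixpoint first_visit_prob (R : realType) (p : nat -> nat -> R) (k i j : nat)
    : \bar R :=
  match k with
  | 0%N => 0%E
  | 1%N => (p i j)%:E
  | k'.+1 =>
      (\sum_(0 <= l <oo | l != j) (p i l)%:E * first_visit_prob p k' l j)%E
  end.

Definition irreducible_chain (R : realType) (p : nat -> nat -> R) : Prop :=
  forall i j, exists k, (0 < step_prob p k i j)%E.

(* The gcd of the possible return times of every state is 1. *)
Definition aperiodic_chain (R : realType) (p : nat -> nat -> R) : Prop :=
  forall i g,
    (forall k, (0 < k)%N -> (0 < step_prob p k i i)%E -> (g %| k)%N) ->
    g = 1%N.

Definition positive_recurrent_chain (R : realType) (p : nat -> nat -> R)
    : Prop :=
  forall i,
    (\sum_(0 <= k <oo) first_visit_prob p k i i = 1)%E /\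
    (\sum_(0 <= k <oo) k%:R%:E * first_visit_prob p k i i < +oo)%E.

Definition ergodic_chain (R : realType) (p : nat -> nat -> R) : Prop :=
  [/\ irreducible_chain p, aperiodic_chain p & positive_recurrent_chain p].

(* Main.v *)
Require Import Defs.
From HB Require Import structures.
From mathcomp Require Import all_boot all_order all_algebra.
From mathcomp Require Import all_classical all_reals all_analysis.
From mathcomp Require Import measurable_realfun ring lra.

(** The chain decreases by at most one at each step, and from every state m + 1
    it moves to m + j with the same positive probability c_j. If
    C = sum_j j c_j < 1, Foster's criterion applies to every state i, with a
    Lyapunov function that is linear above i and constant below i.
    Conversely let h m be the mean hitting time of 0 from m. Being unable to
    jump over levels downwards, the chain has h (m + 1) >= h m + h 1, so
    conditioning on the first step gives h 1 >= 1 + C h 1, which forces C < 1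
    when h 1 is finite.

    To compute C, let S_n be the n-th birth epoch. Since births occur at rate
    r_n in state n, P(S_{n+1} <= t) is the integral of r_n P(N(s) = n) over
    s <= t. Summing over n, and using P(N(s) = 0) = exp(- l s), the mean number
    of births by time t is (1 - lp / l) (1 - exp(- l t)) + lp t for the rates
    l, lp, lp, ..., and integrating against b gives the mean number of arrivals
    during a service, (1 - lp / l) (1 - LST b l) + lp * mean b. *)

Set Implicit Arguments.
Unset Strict Implicit.
Unset Printing Implicit Defensive.

Import Order.TTheory GRing.Theory Num.Theory.
Import numFieldNormedType.Exports.

Local Open Scope classical_set_scope.
Local Open Scope ring_scope.

(** * Mean return times *)

Lemma nneseries_le_bound (R : realType) (u : nat -> \bar R) (c : \bar R) :
  (forall n, (0 <= u n)%E) ->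
  (forall n, (\sum_(0 <= k < n) u k <= c)%E) -> (\sum_(0 <= k <oo) u k <= c)%E.
Proof.
by move=> u0 uc; apply: lime_le; [exact: is_cvg_nneseries|exact: nearW].
Qed.

Section hitting_times.
Variables (R : realType) (p : nat -> nat -> R).
Hypothesis p_ge0 : forall m n, 0 <= p m n.
Hypothesis p_sum : forall m, (\sum_(0 <= n <oo) (p m n)%:E = 1)%E.
Local Open Scope ereal_scope.

(* The probability, from m, that the first visit to i at a time >= 1 takes
   place after time k. *)
Fixpoint survival (i k m : nat) : \bar R :=
  if k is k'.+1 then
    \sum_(0 <= l <oo | l != i) (p m l)%:E * survival i k' l
  else 1.

(** The tail-sum formula E T = sum_k P(T > k) for the time T >= 1 of the first visit to i; for m = i
    it is the mean return time. *)
Definition hitting_mean (i m : nat) : \bar R :=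
  \sum_(0 <= k <oo) survival i k m.

Lemma survival_ge0 i k m : 0 <= survival i k m.
Proof.
elim: k m => //= k IH m; apply: nneseries_ge0 => n _ _.
by rewrite mule_ge0// lee_fin.
Qed.

Lemma first_visit_ge0 i k m : 0 <= first_visit_prob p k m i.
Proof.
elim: k m => // -[|k] IH m; first by rewrite /= lee_fin.
by apply: nneseries_ge0 => n _ _; rewrite mule_ge0 ?lee_fin//; exact: IH.
Qed.

Lemma hitting_mean_ge0 i m : 0 <= hitting_mean i m.
Proof. by apply: nneseries_ge0 => k _ _; exact: survival_ge0. Qed.

(** No visit up to time k leaves two cases: the first visit is at time k + 1, or it is later still.
    Conditioning on the first step reduces this to k = 0, where the row sums to 1. *)
Lemma first_visit_survival i k m :
  first_visit_prob p k.+1 m i + survival i k.+1 m = survival i k m.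
Proof.
elim: k m => [|k IH] m.
  rewrite /= -[RHS](p_sum m) (@nneseriesD1 _ _ i)//; last first.
    by move=> k _; rewrite lee_fin.
  by congr (_ + _); apply: eq_eseriesr => l _; rewrite mule1.
transitivity (\sum_(0 <= l <oo | l != i)
   ((p m l)%:E * first_visit_prob p k.+1 l i + (p m l)%:E * survival i k.+1 l)).
  rewrite nneseriesD// => l _ _; rewrite mule_ge0 ?lee_fin ?survival_ge0//.
  exact: first_visit_ge0.
apply: eq_eseriesr => l _.
by rewrite -ge0_muleDr ?IH ?survival_ge0 ?first_visit_ge0.
Qed.

Lemma sum_first_visit i m K :
  \sum_(0 <= k < K.+1) first_visit_prob p k m i + survival i K m = 1.
Proof.
elim: K => [|K IH]; first by rewrite big_nat1 /= add0e.
by rewrite big_nat_recr//= -addeA first_visit_survival.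
Qed.

(** Summation by parts. The boundary term at K is kept, so that the identity is exact for finite
    sums. *)
Lemma sum_mul_first_visit i m K :
  \sum_(0 <= k < K.+1) k%:R%:E * first_visit_prob p k m i
    + K%:R%:E * survival i K m = \sum_(0 <= k < K) survival i k m.
Proof.
elim: K => [|K IH]; first by rewrite big_nat1 big_geq// !mul0e adde0.
rewrite big_nat_recr// [RHS]big_nat_recr// -IH -[LHS]addeA.
rewrite -(ge0_muleDr _ (first_visit_ge0 _ _ _) (survival_ge0 _ _ _)).
rewrite first_visit_survival -[in X in _ + X]natr1 EFinD.
by rewrite ge0_muleDl ?lee_fin// mul1e [LHS]addeA.
Qed.

Lemma return_of_hitting i : hitting_mean i i < +oo ->
  \sum_(0 <= k <oo) first_visit_prob p k i i = 1 /\
  \sum_(0 <= k <oo) k%:R%:E * first_visit_prob p k i i < +oo.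
Proof.
move=> hi; split.
  apply/eqP; rewrite eq_le; apply/andP; split.
    apply: nneseries_le_bound => [k|K]; first exact: first_visit_ge0.
    case: K => [|K]; first by rewrite big_geq.
    by rewrite -(sum_first_visit i i K) leeDl// survival_ge0.
  set F := \sum_(0 <= k <oo) _.
  have F0 : 0 <= F by apply: nneseries_ge0 => k _ _; exact: first_visit_ge0.
  (* The remainder of the convergent survival series from K on dominates its first term
     [survival i K i], so F plus this remainder is at least 1 for every K, while the remainder tends
     to 0. *)
  have cv : (F + \sum_(N <= k <oo) survival i k i) @[N --> \oo] --> F + 0.
    apply: cvgeD; first by rewrite ge0_adde_def// inE.
      exact: cvg_cst.
    by apply: nneseries_tail_cvg => // k _; exact: survival_ge0.
  rewrite -[leRHS]adde0 -(cvg_lim _ cv)//; apply: lime_ge; first exact: cvgP cv.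
  apply: nearW => K; rewrite -(sum_first_visit i i K); apply: leeD.
    by apply: nneseries_lim_ge => *; exact: first_visit_ge0.
  rewrite (nneseries_split K 1); last by move=> *; exact: survival_ge0.
  by rewrite addn1 big_nat1 leeDl// nneseries_ge0// => *; exact: survival_ge0.
apply: le_lt_trans hi; apply: nneseries_le_bound => [k|K].
  by rewrite mule_ge0 ?lee_fin ?first_visit_ge0.
case: K => [|K]; first by rewrite big_geq// hitting_mean_ge0.
apply: le_trans (_ : \sum_(0 <= k < K) survival i k i <= _).
  by rewrite -sum_mul_first_visit leeDl// mule_ge0 ?lee_fin// survival_ge0.
by apply: nneseries_lim_ge => *; exact: survival_ge0.
Qed.

Lemma hitting_of_return i :
  \sum_(0 <= k <oo) first_visit_prob p k i i = 1 ->
  \sum_(0 <= k <oo) k%:R%:E * first_visit_prob p k i i < +oo ->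
  hitting_mean i i < +oo.
Proof.
move=> F1; apply: le_lt_trans; apply: nneseries_le_bound => [k|K].
  exact: survival_ge0.
(* As the first-visit probabilities sum to 1, P(T > K) is the mass of the first visits after K.
   Hence K P(T > K) is at most the part k > K of the mean, which absorbs the boundary term. *)
have sK : survival i K i = \sum_(K.+1 <= k <oo) first_visit_prob p k i i.
  have := sum_first_visit i i K; rewrite -F1.
  rewrite [RHS](nneseries_split 0 K.+1) ?add0n; last first.
    by move=> *; exact: first_visit_ge0.
  set S := \sum_(0 <= k < K.+1) _.
  suff Sfin : S \is a fin_num.
    by move=> /(congr1 (fun x => x - S)); rewrite ![S + _]addeC !addeK.
  rewrite ge0_fin_numE; last by rewrite sume_ge0// => *; exact: first_visit_ge0.
  apply: le_lt_trans (ltry 1); rewrite -(sum_first_visit i i K) leeDl//.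
  exact: survival_ge0.
rewrite -sum_mul_first_visit [leRHS](nneseries_split 0 K.+1) ?add0n; last first.
  by move=> *; rewrite mule_ge0 ?lee_fin ?first_visit_ge0.
rewrite leeD2l// sK -nneseriesZl; last by move=> *; exact: first_visit_ge0.
rewrite [leLHS]eseries_cond [leRHS]eseries_cond; apply: lee_nneseries => k.
  by move=> *; rewrite mule_ge0 ?lee_fin ?first_visit_ge0.
move=> /andP[_ Kk]; rewrite lee_wpmul2r ?first_visit_ge0// lee_fin ler_nat.
exact: ltnW.
Qed.

(** First-step analysis with a finite horizon: the horizon drops by one, which allows induction on K
    without any finiteness assumption. *)
Lemma partial_hitting_rec i m K :
  \sum_(0 <= k < K.+1) survival i k m =
  1 + \sum_(0 <= l <oo | l != i)
        (p m l)%:E * \sum_(0 <= k < K) survival i k l.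
Proof.
rewrite big_nat_recl//=; congr (_ + _).
under eq_bigr do rewrite eseries_mkcond.
rewrite -nneseries_sum_nat.
  rewrite [RHS]eseries_mkcond; apply: eq_eseriesr => l _.
  case: ifPn => li; last by rewrite big1.
  by rewrite ge0_sume_distrr// => k _; exact: survival_ge0.
move=> k l; case: ifP => // _; rewrite mule_ge0 ?lee_fin ?survival_ge0//.
Qed.

Lemma hitting_mean_rec i m : hitting_mean i m =
  1 + \sum_(0 <= l <oo | l != i) (p m l)%:E * hitting_mean i l.
Proof.
have s0 k l : 0 <= (p m l)%:E * survival i k l.
  by rewrite mule_ge0 ?lee_fin ?survival_ge0.
rewrite /hitting_mean nneseries_recl//; last by move=> *; exact: survival_ge0.
congr (_ + _); rewrite -nneseries_addn; last by move=> *; exact: survival_ge0.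
under eq_eseriesr do rewrite addn1/=.
rewrite nneseries_interchange//; apply: eq_eseriesr => l _.
by rewrite nneseriesZl// => *; exact: survival_ge0.
Qed.

(** The hitting means are the least nonnegative solution of the first-step inequalities: every
    truncated mean stays below V by induction on the horizon. *)
Lemma hitting_mean_le i (V : nat -> \bar R) : (forall m, 0 <= V m) ->
  (forall m, m != i ->
    1 + \sum_(0 <= l <oo | l != i) (p m l)%:E * V l <= V m) ->
  forall m, m != i -> hitting_mean i m <= V m.
Proof.
move=> V0 VP m mi; apply: nneseries_le_bound => [k|K].
  exact: survival_ge0.
elim: K m mi => [|K IH] m mi; first by rewrite big_geq.
rewrite partial_hitting_rec (le_trans _ (VP m mi))// leeD2l//.
apply: lee_nneseries => l.
  move=> _ _; rewrite mule_ge0 ?lee_fin// sume_ge0// => *; exact: survival_ge0.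
by move=> li; rewrite lee_wpmul2l ?lee_fin// IH.
Qed.

(** Foster's criterion. V bounds the mean hitting times of i from the other states, and one more
    first step bounds the mean return time. *)
Lemma positive_recurrent_of_drift i (V : nat -> \bar R) :
  (forall m, 0 <= V m) ->
  (forall m, m != i ->
    1 + \sum_(0 <= l <oo | l != i) (p m l)%:E * V l <= V m) ->
  \sum_(0 <= l <oo | l != i) (p i l)%:E * V l < +oo ->
  \sum_(0 <= k <oo) first_visit_prob p k i i = 1 /\
  \sum_(0 <= k <oo) k%:R%:E * first_visit_prob p k i i < +oo.
Proof.
move=> V0 VP Vi; apply: return_of_hitting; rewrite hitting_mean_rec.
rewrite lte_add_pinfty ?ltry//; apply: le_lt_trans Vi; apply: lee_nneseries.
  by move=> l _ _; rewrite mule_ge0 ?lee_fin ?hitting_mean_ge0.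
by move=> l li; rewrite lee_wpmul2l ?lee_fin//; exact: hitting_mean_le li.
Qed.

(** If the mean from m were infinite, the first step to m alone would make the mean return time
    infinite. *)
Lemma hitting_mean_lty i m : hitting_mean i i < +oo -> m != i ->
  (0 < p i m)%R -> hitting_mean i m < +oo.
Proof.
have ph0 l : 0 <= (p i l)%:E * hitting_mean i l.
  by rewrite mule_ge0 ?lee_fin ?hitting_mean_ge0.
move=> hi mi pm; rewrite ltey; apply/eqP => hm; move: hi.
rewrite hitting_mean_rec (@nneseriesD1 _ _ m)// hm gt0_muley ?lte_fin//.
by rewrite addye ?addey// gt_eqF// (lt_le_trans (ltNyr 0))// nneseries_ge0.
Qed.

End hitting_times.

(** * Skip-free chains *)

Section skip_free_chain.
Variables (R : realType) (c0 c : nat -> R).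
Hypotheses (c0_gt0 : forall n, 0 < c0 n) (c_gt0 : forall n, 0 < c n).
Hypothesis c0_sum : (\sum_(0 <= n <oo) (c0 n)%:E = 1)%E.
Hypothesis c_sum : (\sum_(0 <= n <oo) (c n)%:E = 1)%E.

(** The transition matrix of M/G/1 type: [c] is the law of one plus the increment from any positive
    state, and [c0] is the law of the next state from 0. *)
Definition skip_free_chain (m n : nat) : R :=
  if m is m'.+1 then if (m' <= n)%N then c (n - m') else 0 else c0 n.

Local Notation p := skip_free_chain.
Local Open Scope ereal_scope.

Lemma skip_free_ge0 m n : (0 <= p m n)%R.
Proof. by case: m => [|m] /=; [exact: ltW|case: ifP => // _; exact: ltW]. Qed.

Lemma skip_free_gt0 m n : (m <= n.+1)%N -> (0 < p m n)%R.
Proof. by case: m => [|m] //=; rewrite ltnS => ->. Qed.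

Lemma skip_free_series m (G : nat -> \bar R) : (forall l, 0 <= G l) ->
  \sum_(0 <= l <oo) (p m.+1 l)%:E * G l =
  \sum_(0 <= j <oo) (c j)%:E * G (m + j)%N.
Proof.
move=> G0.
have pG0 l : 0 <= (p m.+1 l)%:E * G l.
  by rewrite mule_ge0 ?lee_fin ?skip_free_ge0.
rewrite (nneseries_split 0 m)// add0n big_nat_cond big1 ?add0e; last first.
  by move=> l /andP[/andP[_ lm] _]; rewrite /= leqNgt lm mul0e.
rewrite -nneseries_addn//; apply: eq_eseriesr => j _.
by rewrite /= leq_addl addnK addnC.
Qed.

Lemma skip_free_sum m : \sum_(0 <= n <oo) (p m n)%:E = 1.
Proof.
case: m => [|m]; first exact: c0_sum.
under eq_eseriesr do rewrite -[(_)%:E]mule1.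
rewrite (@skip_free_series m (fun=> 1))//.
by under eq_eseriesr do rewrite mule1; exact: c_sum.
Qed.

(** Descend one level at a time to 0, from which any j is reached in one step. *)
Lemma skip_free_irreducible : irreducible_chain p.
Proof.
have step0 k i j : 0 <= step_prob p k i j.
  elim: k i => [|k IH] i /=; first by rewrite lee_fin.
  by apply: nneseries_ge0 => *; rewrite mule_ge0 ?lee_fin ?skip_free_ge0.
have stepS k i l j : (0 < p i l)%R -> 0 < step_prob p k l j ->
    0 < step_prob p k.+1 i j.
  move=> pil slj /=; rewrite (@nneseriesD1 _ _ l)//; last first.
    by move=> *; rewrite mule_ge0 ?lee_fin ?skip_free_ge0.
  apply: lt_le_trans (leeDl _ _); first by rewrite mule_gt0// lte_fin.
  by apply: nneseries_ge0 => *; rewrite mule_ge0 ?lee_fin ?skip_free_ge0.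
move=> i j; elim: i => [|i [k IH]].
  exists 1%N; apply: (@stepS _ _ j); first exact: skip_free_gt0.
  by rewrite /= eqxx lte_fin.
by exists k.+1; apply: stepS IH; exact: skip_free_gt0.
Qed.

(** Every state returns to itself in one step with positive probability. *)
Lemma skip_free_aperiodic : aperiodic_chain p.
Proof.
move=> i g /(_ 1%N isT) gP; apply/eqP; rewrite -dvdn1; apply: gP => /=.
rewrite (@nneseriesD1 _ _ i)//; last first.
  by move=> *; rewrite mule_ge0 ?lee_fin ?skip_free_ge0.
apply: lt_le_trans (leeDl _ _).
  by rewrite eqxx mule1 lte_fin skip_free_gt0.
by apply: nneseries_ge0 => *; rewrite mule_ge0 ?lee_fin ?skip_free_ge0.
Qed.

End skip_free_chain.

(** * Sufficiency of the drift condition, by Foster's criterion *)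

Lemma positive_lower_bound (R : realType) (f : nat -> R) n :
  (forall m, (m <= n)%N -> 0 < f m) ->
  exists2 d : R, 0 < d & forall m, (m <= n)%N -> d <= f m.
Proof.
elim: n => [|n IH] f0.
  by exists (f 0%N) => [|m]; [exact: f0|rewrite leqn0 => /eqP ->].
have [d d0 dP] : exists2 d : R, 0 < d & forall m, (m <= n)%N -> d <= f m.
  by apply: IH => m mn; apply: f0; rewrite leqW.
exists (Num.min d (f n.+1)) => [|m]; first by rewrite lt_min d0 f0.
rewrite leq_eqVlt => /predU1P[->|]; first by rewrite ge_min lexx orbT.
by rewrite ltnS => /dP dm; rewrite ge_min dm.
Qed.

Section skip_free_recurrence.
Variables (R : realType) (c0 c : nat -> R).
Hypotheses (c0_gt0 : forall n, 0 < c0 n) (c_gt0 : forall n, 0 < c n).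
Hypothesis c0_sum : (\sum_(0 <= n <oo) (c0 n)%:E = 1)%E.
Hypothesis c_sum : (\sum_(0 <= n <oo) (c n)%:E = 1)%E.

Local Notation p := (skip_free_chain c0 c).
Local Open Scope ereal_scope.

Let p_ge0 := skip_free_ge0 c0_gt0 c_gt0.
Let p_sum := skip_free_sum c0_gt0 c_gt0 c0_sum c_sum.
Let ce_ge0 n : 0 <= (c n)%:E. Proof. by rewrite lee_fin ltW. Qed.

Lemma skip_free_positive_recurrent :
  \sum_(0 <= n <oo) (n%:R * c0 n)%:E < +oo ->
  \sum_(0 <= n <oo) (n%:R * c n)%:E < 1 ->
  positive_recurrent_chain p.
Proof.
move=> m0_fin mc_lt1 i.
set m0 := \sum_(0 <= n <oo) _ in m0_fin.
set mc := \sum_(0 <= n <oo) _ in mc_lt1.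
have m0_ge0 : 0 <= m0.
  by apply: nneseries_ge0 => n _ _; rewrite lee_fin mulr_ge0// ltW.
have mc_ge0 : 0 <= mc.
  by apply: nneseries_ge0 => n _ _; rewrite lee_fin mulr_ge0// ltW.
have [x0 m0E] : exists x, m0 = x%:E.
  by exists (fine m0); rewrite fineK// ge0_fin_numE.
have [x mcE] : exists x, mc = x%:E.
  by exists (fine mc); rewrite fineK// ge0_fin_numE// (lt_trans mc_lt1)// ltry.
move: m0_ge0 mc_ge0 mc_lt1; rewrite m0E mcE !lee_fin lte_fin.
move=> x0_ge0 x_ge0 x_lt1.
have eps_gt0 : (0 < 1 - x)%R by rewrite subr_gt0.
have [d d_gt0 dP] : exists2 d : R, (0 < d)%R &
    forall m, (m <= i)%N -> (d <= p m i)%R.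
  apply: positive_lower_bound => m mi.
  by apply: skip_free_gt0 => //; rewrite leqW.
(* Truncated subtraction: W vanishes up to level i. *)
pose W (l : nat) : R := ((l - i)%:R / (1 - x))%R.
have W_ge0 l : (0 <= W l)%R by rewrite divr_ge0// ltW.
(* D bounds the mean of W after one step from any state m <= i: the part with x0 serves m = 0, the
   part with x serves m > 0. *)
pose D : R := ((x0 + x) / (1 - x))%R.
have D_ge0 : (0 <= D)%R by apply: divr_ge0; [exact: addr_ge0|exact: ltW].
(* From above i the chain lands at level i or higher, where the truncated subtraction is exact. So W
   is linear there, and the factor 1 / (1 - x) turns the mean increment x - 1 into -1. *)
have W_far m : (i < m)%N ->
    \sum_(0 <= l <oo) (p m l)%:E * (W l)%:E = (W m - 1)%:E.
  case: m => // m; rewrite ltnS => im.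
  rewrite skip_free_series//.
  transitivity (\sum_(0 <= j <oo) (((m - i)%:R / (1 - x))%:E * (c j)%:E
     + ((1 - x)^-1)%:E * (j%:R * c j)%:E)).
    apply: eq_eseriesr => j _; rewrite -!EFinM -EFinD; congr (_%:E).
    by rewrite /W addnC -addnBA// natrD; ring.
  rewrite nneseriesD; last 2 first.
  - by move=> j _ _; rewrite -EFinM lee_fin mulr_ge0 ?divr_ge0// ltW.
  - by move=> j _ _; rewrite -EFinM lee_fin !mulr_ge0 ?invr_ge0// ltW.
  rewrite nneseriesZl; last by move=> j _; exact: ce_ge0.
  rewrite nneseriesZl; last first.
    by move=> j _; rewrite lee_fin mulr_ge0// ltW.
  rewrite c_sum -/mc mcE -!EFinM -EFinD /W subSn// -natr1; congr (_%:E).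
  by field; rewrite gt_eqF.
have W_near m : (m <= i)%N -> \sum_(0 <= l <oo) (p m l)%:E * (W l)%:E <= D%:E.
  move=> mi.
  have near_bound (q : nat -> R) y k : (forall n, 0 < q n)%R -> (k <= i)%N ->
      \sum_(0 <= n <oo) (n%:R * q n)%:E = y%:E ->
      \sum_(0 <= l <oo) (q l)%:E * (W (k + l)%N)%:E <= (y / (1 - x))%:E.
    move=> q0 ki qy; rewrite mulrC EFinM -qy -nneseriesZl; last first.
      by move=> j _; rewrite lee_fin mulr_ge0// ltW.
    apply: lee_nneseries => l; first by rewrite -EFinM lee_fin mulr_ge0// ltW.
    rewrite -!EFinM lee_fin => _.
    have -> : ((1 - x)^-1 * (l%:R * q l) = q l * (l%:R / (1 - x)))%R by ring.
    rewrite ler_pM2l// ler_pM2r ?invr_gt0// ler_nat.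
    by rewrite leq_subLR leq_add2r.
  case: m mi => [|m] mi.
    apply: le_trans (near_bound c0 x0 0%N _ _ _) _ => //.
    by rewrite lee_fin ler_pM2r ?invr_gt0// lerDl.
  rewrite skip_free_series//.
  apply: le_trans (near_bound c x m _ _ _) _ => //; first exact: ltnW.
  by rewrite lee_fin ler_pM2r ?invr_gt0// lerDr.
(* B solves 1 + D + B (1 - d) = B, the drift condition in the worst case for a state at or below
   i. *)
pose B : R := ((1 + D) / d)%R.
have B_ge0 : (0 <= B)%R by apply: divr_ge0; [exact: addr_ge0|exact: ltW].
(* From above i the chain has to hit i on its way down; from below, it hits i
   in one step with probability at least d. *)
pose V l : R := if (l <= i)%N then B else W l.
have V_ge0 l : (0 <= V l)%R by rewrite /V; case: ifP.
have V_near m : (m <= i)%N ->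
    1 + \sum_(0 <= l <oo | l != i) (p m l)%:E * (V l)%:E <= B%:E.
  move=> mi.
  have pVle : \sum_(0 <= l <oo | l != i) (p m l)%:E * (V l)%:E <=
      (B * (1 - p m i))%:E + D%:E.
    apply: le_trans (_ : \sum_(0 <= l <oo | l != i)
      (B%:E * (p m l)%:E + (p m l)%:E * (W l)%:E) <= _).
      apply: lee_nneseries => l; first by rewrite -EFinM lee_fin mulr_ge0.
      rewrite -!EFinM -EFinD lee_fin mulrC [(p m l * W l)%R]mulrC -mulrDl => _.
      by rewrite ler_wpM2r// /V; case: ifP => _; rewrite ?lerDl ?lerDr.
    rewrite nneseriesD; last 2 first.
    - by move=> l _ _; rewrite -EFinM lee_fin mulr_ge0.
    - by move=> l _ _; rewrite -EFinM lee_fin mulr_ge0.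
    apply: leeD.
      rewrite nneseriesZl; last by move=> l _; rewrite lee_fin.
      rewrite [leRHS]EFinM lee_wpmul2l ?lee_fin// EFinB leeBrDr//.
      rewrite addeC -(@nneseriesD1 _ _ i xpredT) ?p_sum//.
      by move=> l _; rewrite lee_fin.
    apply: le_trans (W_near m mi); apply: subset_lee_nneseries => // l _.
    by rewrite -EFinM lee_fin mulr_ge0.
  apply: le_trans (leeD2l _ pVle) _; rewrite -!EFinD lee_fin.
  have -> : (1 + (B * (1 - p m i) + D) = B + (B * d - B * p m i))%R.
    by rewrite /B; field; rewrite gt_eqF.
  by rewrite gerDl subr_le0 ler_wpM2l// dP.
apply: (@positive_recurrent_of_drift _ _ p_ge0 p_sum i (fun l => (V l)%:E)).
- by move=> m; rewrite lee_fin.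
- move=> m mi; rewrite {2}/V; case: ifPn => [|im]; first exact: V_near.
  rewrite -ltnNge in im.
  rewrite -[leRHS](_ : 1 + (W m - 1)%:E = _); last by rewrite -EFinD subrKC.
  rewrite leeD2l// -W_far// eseries_mkcond; apply: lee_nneseries => l.
    by move=> _ _; case: ifP => // _; rewrite -EFinM lee_fin mulr_ge0.
  move=> _; case: ifPn => [li|_]; last by rewrite -EFinM lee_fin mulr_ge0.
  rewrite /V; case: ifPn => [li'|//].
  have lti : (l < i)%N by rewrite ltn_neqAle li.
  have -> : p m l = 0%R; last by rewrite !mul0e.
  by case: m im {mi} => // m im /=; rewrite leqNgt (leq_trans lti).
- apply: le_lt_trans (ltry B); apply: le_trans (V_near i _) => //.
  by rewrite leeDr.
Qed.

End skip_free_recurrence.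

(** * Necessity of the drift condition *)

Section skip_free_transience.
Variables (R : realType) (c0 c : nat -> R).
Hypotheses (c0_gt0 : forall n, 0 < c0 n) (c_gt0 : forall n, 0 < c n).
Hypothesis c0_sum : (\sum_(0 <= n <oo) (c0 n)%:E = 1)%E.
Hypothesis c_sum : (\sum_(0 <= n <oo) (c n)%:E = 1)%E.

Local Notation p := (skip_free_chain c0 c).
Local Open Scope ereal_scope.

Let p_ge0 := skip_free_ge0 c0_gt0 c_gt0.
Let p_sum := skip_free_sum c0_gt0 c_gt0 c0_sum c_sum.
(** Setting the value at 0 to 0 replaces the restriction l != 0 in the recursions by a full series,
    which can be reindexed by the increment. *)
Let killed (G : nat -> \bar R) l : \bar R := if l == 0%N then 0 else G l.
Let h := hitting_mean p 0.
(** This is E min(T, K) for the hitting time T of 0 from m, a truncation of [h] suited to induction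
    on K. *)
Let H K m := \sum_(0 <= k < K) survival p 0 k m.

Let H_ge0 K m : 0 <= H K m.
Proof. by apply: sume_ge0 => k _; exact: survival_ge0. Qed.

Let h_ge0 m : 0 <= h m. Proof. exact: hitting_mean_ge0. Qed.

Let killed_ge0 G l : (forall m, 0 <= G m) -> 0 <= killed G l.
Proof. by rewrite /killed; case: ifP. Qed.

Let cH_ge0 K j m : 0 <= (c j)%:E * killed (H K) m.
Proof.
apply: mule_ge0; first by rewrite lee_fin ltW.
by apply: killed_ge0; exact: H_ge0.
Qed.

Let killed_series m G : (forall l, 0 <= G l) ->
  \sum_(0 <= l <oo | l != 0%N) (p m.+1 l)%:E * G l =
  \sum_(0 <= j <oo) (c j)%:E * killed G (m + j)%N.
Proof.
move=> G0; rewrite -(skip_free_series c0_gt0 c_gt0); last first.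
  by move=> l; exact: killed_ge0.
rewrite eseries_mkcond; apply: eq_eseriesr => l _.
by rewrite /killed; case: eqP => //=; rewrite mule0.
Qed.

Let H_rec K m : H K.+1 m.+1 =
  1 + \sum_(0 <= j <oo) (c j)%:E * killed (H K) (m + j)%N.
Proof.
by rewrite [LHS](partial_hitting_rec p_ge0) killed_series// => l; exact: H_ge0.
Qed.

Let h_rec m : h m.+1 = 1 + \sum_(0 <= j <oo) (c j)%:E * killed h (m + j)%N.
Proof. by rewrite [LHS](hitting_mean_rec p_ge0) killed_series. Qed.

(** The increments have the same law at all positive levels, so the recursions from m + 1 and m + 2
    compare term by term. *)
Let H_nondecreasing K m : killed (H K) m <= killed (H K) m.+1.
Proof.
elim: K m => [|K IH] [|m]; rewrite {1}/killed/=.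
- by apply: killed_ge0; exact: H_ge0.
- by rewrite /H big_geq//; apply: killed_ge0; exact: H_ge0.
- by apply: killed_ge0; exact: H_ge0.
- rewrite /killed/= !H_rec leeD2l//; apply: lee_nneseries => j.
    by move=> _ _; exact: cH_ge0.
  move=> _; apply: lee_wpmul2l; first by rewrite lee_fin ltW.
  by rewrite addSn; exact: IH.
Qed.

(* By left skip-freeness, reaching 0 from m + 1 requires first descending by
   one level, in mean time h 1, and then reaching the level m below. *)
Let h_superadditive x K m : h 1%N = x%:E ->
  killed (H K) m + x%:E <= h m.+1.
Proof.
move=> h1E.
have x_ge0 : (0 <= x)%R by rewrite -lee_fin -h1E.
elim: K m => [|K IH] m.
  (* With horizon 0 only h 1 <= h (m + 1) is left, which is monotonicity in the starting level for
     each truncation. *)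
  have -> : killed (H 0%N) m = 0 by rewrite /killed /H big_geq// if_same.
  rewrite add0e -h1E; apply: nneseries_le_bound => [k|K].
    exact: survival_ge0.
  rewrite -/(H K 1) (le_trans (_ : _ <= H K m.+1))//.
    by elim: m => // m /le_trans; apply; exact: (H_nondecreasing K m.+1).
  by apply: nneseries_lim_ge => *; exact: survival_ge0.
case: m => [|m]; first by rewrite /killed/= add0e h1E.
rewrite {1}/killed/= H_rec h_rec -addeA leeD2l//.
(* Since the c_j sum to 1, x can be distributed over the series and the two sides compared for each
   j. *)
rewrite -[x%:E]mule1 -c_sum -nneseriesZl; last first.
  by move=> j _; rewrite lee_fin ltW.
rewrite -nneseriesD => [|*|*]; [|exact: cH_ge0|]; last first.
  by rewrite -EFinM lee_fin mulr_ge0// ltW.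
apply: lee_nneseries => j.
  move=> _ _; apply: adde_ge0; first exact: cH_ge0.
  by rewrite -EFinM lee_fin mulr_ge0// ltW.
move=> _; rewrite [x%:E * _]muleC -ge0_muleDr ?lee_fin//; last first.
  by apply: killed_ge0; exact: H_ge0.
apply: lee_wpmul2l; first by rewrite lee_fin ltW.
by rewrite addSn; exact: IH.
Qed.

Lemma skip_free_drift : positive_recurrent_chain p ->
  \sum_(0 <= n <oo) (n%:R * c n)%:E < 1.
Proof.
move=> /(_ 0%N)[f1 fm].
have [x h1E] : exists x, h 1%N = x%:E.
  exists (fine (h 1%N)); rewrite fineK// ge0_fin_numE//.
  by apply: (hitting_mean_lty p_ge0) => //; exact: hitting_of_return.
have x_ge0 : (0 <= x)%R by rewrite -lee_fin -h1E.
(* The bound holds for all truncations, hence for [h]; iterating it gives h j >= j x. *)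
have hS m : killed h m + x%:E <= h m.+1.
  rewrite -leeBrDr// /killed; case: eqP => [m0|/eqP m0].
    by have := h_superadditive 0 m h1E; rewrite m0 /killed/= -leeBrDr.
  apply: nneseries_le_bound => [k|K]; first exact: survival_ge0.
  by have := h_superadditive K m h1E; rewrite /killed (negbTE m0) -leeBrDr.
have hj j : (j%:R * x)%:E <= killed h j.
  elim: j => [|j IH]; first by rewrite mul0r.
  by rewrite -natr1 mulrDl mul1r EFinD (le_trans _ (hS j))// leeD2r.
(* If the mean C of [c] were at least 1, then x = h 1 >= 1 + C x >= 1 + x, impossible for finite
   x. *)
rewrite ltNge; apply/negP => mc.
have : (1 + x)%:E <= x%:E; last by rewrite lee_fin gerDr ler10.
rewrite -[leRHS]h1E h_rec EFinD leeD2l// -[leLHS]mule1.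
apply: le_trans (lee_wpmul2l _ mc) _; first by rewrite lee_fin.
rewrite -nneseriesZl; last by move=> j _; rewrite lee_fin mulr_ge0// ltW.
apply: lee_nneseries => j.
  by move=> _ _; rewrite -EFinM lee_fin !mulr_ge0// ltW.
move=> _; rewrite -EFinM mulrA mulrC [(x * _)%R]mulrC EFinM add0n.
by rewrite lee_wpmul2l// lee_fin ltW.
Qed.

End skip_free_transience.

(** * Epochs of a pure birth process *)

(** Dynkin's argument: rectangles form a pi-system generating the product sigma-algebra, and the
    sets C satisfying the identity form a lambda-system. *)
Lemma rectangle_independence (R : realType) (d : measure_display)
    (T : measurableType d) (P : probability T R)
    (Z : {mfun T >-> (R * R)%type}) (E : set T) : measurable E ->
  (forall A B : set R, measurable A -> measurable B ->
    P (Z @^-1` (A `*` B) `&` E) = P (Z @^-1` (A `*` B)) * P E)%E ->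
  forall C : set (R * R), measurable C ->
    P (Z @^-1` C `&` E) = (P (Z @^-1` C) * P E)%E.
Proof.
move=> mE rect C.
have mZ (D : set (R * R)) : measurable D -> measurable (Z @^-1` D).
  by move=> mD; exact: measurable_funPTI.
pose Q : set_system (R * R) :=
  [set C | P (Z @^-1` C `&` E) = (P (Z @^-1` C) * P E)%E].
rewrite measurable_prod_measurableType.
apply: (@dynkin_induction _ (R * R)%type _ Q); rewrite /Q /=.
- by rewrite measurable_prod_measurableType.
- move=> _ _ [A1 mA1 [A2 mA2 <-]] [B1 mB1 [B2 mB2 <-]].
  exists (A1 `&` B1); first exact: measurableI.
  by exists (A2 `&` B2); [exact: measurableI|rewrite setXI].
- by rewrite preimage_setT setTI probability_setT mul1e.
- by move=> _ [A mA [B mB <-]]; exact: rect.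
- move=> S mS PS.
  rewrite preimage_setC probability_setC; last exact: mZ.
  rewrite muleBl ?fin_num_measure ?fin_num_adde_defr//.
  rewrite mul1e -PS setIC -setDE measureD//; first by rewrite setIC.
    exact: mZ.
  by rewrite (le_lt_trans (probability_le1 _ _))// ltry.
- move=> F mF tF PF; rewrite preimage_bigcup setI_bigcupl.
  have tZF : trivIset setT (fun n => Z @^-1` F n).
    apply/trivIsetP => i j _ _ ij; rewrite -preimage_setI.
    by move/trivIsetP : tF => ->//; rewrite preimage_set0.
  rewrite !measure_bigcup//; last 3 first.
  + by move=> n _; exact: mZ.
  + by move=> n _; apply: measurableI => //; exact: mZ.
  + apply/trivIsetP => i j _ _ ij; rewrite setIACA.
    by move/trivIsetP : tZF => ->//; rewrite set0I.
  rewrite (eq_eseriesr (fun n _ => PF n)).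
  under eq_eseriesr do rewrite muleC.
  rewrite -[P E]fineK ?fin_num_measure// nneseriesZl; last first.
    by move=> *; exact: measure_ge0.
  by rewrite muleC.
Qed.

(** * Independence of birth epochs and later sojourn times *)

Section birth_epochs.
Context (d : measure_display) (T : measurableType d) (R : realType)
  (P : probability T R) (tau : nat -> {RV P >-> R}).

Lemma measurable_birth_epoch n : measurable_fun setT (birth_epoch tau n).
Proof. by apply: measurable_sum => i; exact: measurable_funPT. Qed.

HB.instance Definition _ n := isMeasurableFun.Build _ _ _ _ (birth_epoch tau n)
  (measurable_birth_epoch n).

(** With the pair as one random variable, events on the next epoch become preimages of plane
    sets. *)
Definition epoch_and_sojourn n (w : T) : R * R :=
  (birth_epoch tau n w, tau n w).

Lemma measurable_epoch_and_sojourn n :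
  measurable_fun setT (epoch_and_sojourn n).
Proof. by apply: measurable_fun_pair; exact: measurable_funPT. Qed.

HB.instance Definition _ n := isMeasurableFun.Build _ _ _ _
  (epoch_and_sojourn n) (measurable_epoch_and_sojourn n).

Lemma birth_epochS n w : birth_epoch tau n.+1 w = birth_epoch tau n w + tau n w.
Proof. by rewrite /birth_epoch big_ord_recr. Qed.

Hypothesis indep : mutually_independent tau.

(** The statement covers all finite families of sojourns from index n on, because the induction
    needs [tau n] jointly with later ones: S_{n+1} = S_n + [tau n], and [rectangle_independence]
    reduces to events that separate the two summands. *)
Lemma epoch_independent n (J : seq nat) (A : nat -> set R) (B : set R) :
  all (leq n) J -> uniq J -> (forall j, measurable (A j)) -> measurable B ->
  let E := \bigcap_(j in [set` J]) (tau j @^-1` A j) in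
  P (birth_epoch tau n @^-1` B `&` E) = (P (birth_epoch tau n @^-1` B) * P E)%E.
Proof.
elim: n J A B => [|n IH] J A B leJ uJ mA mB E.
  have [B0|B0] := pselect (B 0).
    rewrite (_ : birth_epoch tau 0 @^-1` B = setT).
      by rewrite setTI probability_setT mul1e.
    by apply/seteqP; split => // w _ /=; rewrite /birth_epoch big_ord0.
  rewrite (_ : birth_epoch tau 0 @^-1` B = set0).
    by rewrite set0I measure0 mul0e.
  by apply/seteqP; split => // w /=; rewrite /birth_epoch big_ord0.
have mE : measurable E.
  by apply: bigcap_measurableType => // j _; exact: measurable_funPTI.
pose C : set (R * R) := (fun xy : R * R => xy.1 + xy.2) @^-1` B.
have mC : measurable C.
  by rewrite -[C]setTI; apply: measurable_funD.
have -> : birth_epoch tau n.+1 @^-1` B = epoch_and_sojourn n @^-1` C.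
  by apply/seteqP; split => w; rewrite /C /= birth_epochS.
apply: rectangle_independence => // {mC} A1 B1 mA1 mB1.
have nJ : n \notin J by apply/negP => /(allP leJ); rewrite ltnn.
have bigcap_cons (A' : nat -> set R) :
    \bigcap_(j in [set` n :: J]) (tau j @^-1` A' j) =
    tau n @^-1` A' n `&` \bigcap_(j in [set` J]) (tau j @^-1` A' j).
  rewrite (_ : [set` n :: J] = n |` [set` J]) ?bigcap_setU1//.
  apply/seteqP; split => j; rewrite /= inE; first by move=> /predU1P.
  by move=> ?; exact/predU1P.
(* [tau n] joins the family with event [B1]; the other events are unchanged because n is not in
   J. *)
pose A' j := if j == n then B1 else A j.
have mA' j : measurable (A' j) by rewrite /A'; case: ifP.
have A'E : \bigcap_(j in [set` J]) (tau j @^-1` A' j) = E.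
  apply: eq_bigcapr => j /= jJ; rewrite /A'; case: eqP => // jn.
  by rewrite jn (negbTE nJ) in jJ.
have A'n : A' n = B1 by rewrite /A' eqxx.
have tauE : P (tau n @^-1` B1 `&` E) = (P (tau n @^-1` B1) * P E)%E.
  rewrite -A'E -A'n -bigcap_cons !indep//= ?nJ//.
  by rewrite big_cons.
have S1 : P (birth_epoch tau n @^-1` A1 `&` tau n @^-1` B1) =
    (P (birth_epoch tau n @^-1` A1) * P (tau n @^-1` B1))%E.
  have := IH [:: n] (fun=> B1) A1; rewrite /= leqnn set_cons1 bigcap_set1.
  by apply.
have -> : epoch_and_sojourn n @^-1` (A1 `*` B1) =
  birth_epoch tau n @^-1` A1 `&` tau n @^-1` B1 by [].
rewrite -setIA S1 -muleA -tauE -A'n -A'E -bigcap_cons.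
apply: IH => //=; last by rewrite nJ.
by rewrite leqnn; apply: sub_all leJ => j; exact: ltnW.
Qed.

Lemma epoch_sojourn_independent n (A B : set R) :
  measurable A -> measurable B ->
  P (birth_epoch tau n @^-1` A `&` tau n @^-1` B) =
  (P (birth_epoch tau n @^-1` A) * P (tau n @^-1` B))%E.
Proof.
move=> mA mB; have := @epoch_independent n [:: n] (fun=> B) A.
by rewrite /= leqnn set_cons1 bigcap_set1; apply.
Qed.

(** Independence makes the joint law agree with the product measure on rectangles, hence
    everywhere. *)
Lemma epoch_sojourn_law n (C : set (R * R)) : measurable C ->
  P (epoch_and_sojourn n @^-1` C) =
  (\int[distribution P (birth_epoch tau n)]_x
     distribution P (tau n) (xsection C x))%E.
Proof.
move=> mC; symmetry.
apply: (@product_measure_unique _ _ _ _ _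
  (distribution P (birth_epoch tau n)) (distribution P (tau n))
  (distribution P (epoch_and_sojourn n))) => // A B mA mB.
exact: epoch_sojourn_independent.
Qed.

End birth_epochs.

(** Exponential times are nonnegative only almost surely, so the inclusions between epoch events
    below hold up to a null set. *)
Lemma le_measure_null (R : realType) (d : measure_display)
    (T : measurableType d) (mu : {measure set T -> \bar R}) (A B N : set T) :
  measurable A -> measurable B -> measurable N -> mu N = 0%E ->
  A `<=` B `|` N -> (mu A <= mu B)%E.
Proof.
move=> mA mB mN N0 AB; rewrite -(measureU0 mB mN N0).
by apply: le_measure; rewrite ?inE//; exact: measurableU.
Qed.

(** * Distribution functions of the birth epochs *)

Section pure_birth.
Context (d : measure_display) (T : measurableType d) (R : realType)
  (P : probability T R) (rate : nat -> R) (tau : nat -> {RV P >-> R}).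
Hypothesis rate_gt0 : forall n, 0 < rate n.
Hypothesis htau : birth_process_times rate tau.

Let indep : mutually_independent tau := htau.1.
Let law n (A : set R) : measurable A ->
  P (tau n @^-1` A) = exponential_prob (rate n) A.
Proof. exact: htau.2. Qed.

Let mtau n (A : set R) : measurable A -> measurable (tau n @^-1` A).
Proof. by move=> mA; exact: measurable_funPTI. Qed.
Let mepoch n (A : set R) : measurable A ->
  measurable (birth_epoch tau n @^-1` A).
Proof. by move=> mA; exact: measurable_funPTI. Qed.

Lemma sojourn_lt0 n : P (tau n @^-1` `]-oo, 0[) = 0%E.
Proof.
rewrite law// /exponential_prob integral0_eq// => x /=.
by rewrite in_itv/= => x0; rewrite lt0_exponential_pdf.
Qed.

Lemma sojourn_le n x : 0 <= x ->
  P (tau n @^-1` `]-oo, x]) = (1 - expR (- rate n * x))%:E.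
Proof.
move=> x0.
have -> : `]-oo, x]%classic = `[0, x] `|` `]-oo, 0[ :> set R.
  by rewrite setUC -itv_bndbnd_setU// bnd_simp.
transitivity (P (tau n @^-1` `[0, x])).
  rewrite preimage_setU measureU0//; [exact: mtau|exact: mtau|].
  exact: sojourn_lt0.
rewrite law//; move: x0; rewrite le_eqVlt => /predU1P[<-|x0].
  by rewrite set_itv1 /exponential_prob integral_set1 mulr0 expR0 subrr.
by rewrite exponential_prob_itv0c// EFinB.
Qed.

Lemma sojourn_le_lt0 n x : x < 0 -> P (tau n @^-1` `]-oo, x]) = 0%E.
Proof.
move=> x0; apply: subset_measure0 (sojourn_lt0 n); try exact: mtau.
by move=> w /=; rewrite !in_itv/= => /le_lt_trans; apply.
Qed.

Lemma sojourn_gt n x : 0 <= x ->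
  P (tau n @^-1` `]x, +oo[) = (expR (- rate n * x))%:E.
Proof.
move=> x0; have -> : tau n @^-1` `]x, +oo[ = ~` (tau n @^-1` `]-oo, x]).
  by rewrite -setCitvl.
rewrite (probability_setC P (mtau n (measurable_itv _))).
by rewrite sojourn_le// -EFinB opprB addrC subrK.
Qed.

Lemma epoch_lt0 n : P (birth_epoch tau n @^-1` `]-oo, 0[) = 0%E.
Proof.
elim: n => [|n IH].
  rewrite (_ : _ @^-1` _ = set0) ?measure0//; apply/seteqP; split => // w /=.
  by rewrite /birth_epoch big_ord0 in_itv/= ltxx.
apply/eqP; rewrite eq_le measure_ge0 andbT -[leRHS]IH.
apply: (@le_measure_null _ _ _ _ _ _ (tau n @^-1` `]-oo, 0[)).
- exact: mepoch.
- exact: mepoch.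
- exact: mtau.
- exact: sojourn_lt0.
move=> w /=; rewrite !in_itv/= birth_epochS => S0.
have [S0'|S0'] := ltP (birth_epoch tau n w) 0; [by left|right].
by rewrite (le_lt_trans _ S0)// lerDr.
Qed.

Definition epoch_cdf n t := P (birth_epoch tau n @^-1` `]-oo, t]).

Lemma births_eqE t n : births_eq tau t n =
  birth_epoch tau n @^-1` `]-oo, t] `\` birth_epoch tau n.+1 @^-1` `]-oo, t].
Proof.
apply/seteqP; split => w; rewrite /births_eq /= !in_itv/=.
  by move=> /andP[-> /lt_geF ->].
by move=> [-> /negP]; rewrite -ltNge.
Qed.

Lemma measurable_births_eq t n : measurable (births_eq tau t n).
Proof. by rewrite births_eqE; apply: measurableD; exact: mepoch. Qed.

(** Almost surely S_n <= S_{n+1}, so S_{n+1} <= t implies S_n <= t. *)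
Lemma epoch_cdf_births t n :
  epoch_cdf n t = (P (births_eq tau t n) + epoch_cdf n.+1 t)%E.
Proof.
rewrite [LHS](measureDI _ (mepoch n (measurable_itv _))
  (mepoch n.+1 (measurable_itv `]-oo, t]))) -births_eqE.
congr (_ + _)%E; apply/eqP; rewrite eq_le; apply/andP; split.
  apply: le_measure; rewrite ?inE; [|exact: mepoch|exact: subIsetr].
  by apply: measurableI; exact: mepoch.
apply: (@le_measure_null _ _ _ _ _ _ (tau n @^-1` `]-oo, 0[)).
- exact: mepoch.
- by apply: measurableI; exact: mepoch.
- exact: mtau.
- exact: sojourn_lt0.
move=> w /=; rewrite !in_itv/= birth_epochS => St.
have [tau0|tau0] := ltP (tau n w) 0; [by right|left; split => //].
by apply: le_trans St; rewrite lerDl.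
Qed.

Lemma epoch_cdf_decr n t :
  (epoch_cdf n.+1 t <= epoch_cdf n t * P (tau n @^-1` `]-oo, t]))%E.
Proof.
rewrite -epoch_sojourn_independent//.
apply: (@le_measure_null _ _ _ _ _ _
  (birth_epoch tau n @^-1` `]-oo, 0[ `|` tau n @^-1` `]-oo, 0[)).
- exact: mepoch.
- by apply: measurableI; [exact: mepoch|exact: mtau].
- by apply: measurableU; [exact: mepoch|exact: mtau].
- rewrite measureU0; [exact: epoch_lt0|exact: mepoch|exact: mtau|].
  exact: sojourn_lt0.
move=> w /=; rewrite !in_itv/= birth_epochS => St.
have [S0|S0] := ltP (birth_epoch tau n w) 0; first by right; left.
have [tau0|tau0] := ltP (tau n w) 0; [by right; right|left; split].
  by apply: le_trans St; rewrite lerDl.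
by apply: le_trans St; rewrite lerDr.
Qed.

(** Two durations of at most t / 2 add up to at most t; iterated, this makes every epoch
    distribution function positive at positive times. *)
Lemma epoch_cdf_half n t :
  (epoch_cdf n (t / 2)%R * P (tau n @^-1` `]-oo, (t / 2)%R]) <=
   epoch_cdf n.+1 t)%E.
Proof.
rewrite -epoch_sojourn_independent//; apply: le_measure; rewrite ?inE.
- by apply: measurableI; [exact: mepoch|exact: mtau].
- exact: mepoch.
by move=> w /=; rewrite !in_itv/= birth_epochS; lra.
Qed.

(** If S_n <= t and the sojourn in state n exceeds t, then exactly n births have occurred by t. *)
Lemma births_eq_lower n t :
  (epoch_cdf n t * P (tau n @^-1` `]t, +oo[) <= P (births_eq tau t n))%E.
Proof.
rewrite -epoch_sojourn_independent//.
apply: (@le_measure_null _ _ _ _ _ _ (birth_epoch tau n @^-1` `]-oo, 0[)).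
- by apply: measurableI; [exact: mepoch|exact: mtau].
- exact: measurable_births_eq.
- exact: mepoch.
- exact: epoch_lt0.
move=> w /=; rewrite !in_itv/= andbT => -[St taut].
have [S0|S0] := ltP (birth_epoch tau n w) 0; [by right|left].
by rewrite /births_eq /= St birth_epochS (lt_le_trans taut)// lerDr.
Qed.

Lemma epoch_cdf_gt0 n t : 0 < t -> (0 < epoch_cdf n t)%E.
Proof.
elim: n t => [|n IH] t t0.
  rewrite /epoch_cdf (_ : _ @^-1` _ = setT) ?probability_setT ?lte_fin//.
  apply/seteqP; split => // w _ /=.
  by rewrite /birth_epoch big_ord0 in_itv/= ltW.
apply: lt_le_trans (epoch_cdf_half n t); apply: mule_gt0.
  by apply: IH; rewrite divr_gt0.
rewrite sojourn_le ?lte_fin ?subr_gt0 ?expR_lt1; last by rewrite divr_ge0// ltW.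
by rewrite mulNr oppr_lt0 mulr_gt0// divr_gt0.
Qed.

Lemma births_eq_gt0 n t : 0 < t -> (0 < P (births_eq tau t n))%E.
Proof.
move=> t0; apply: lt_le_trans (births_eq_lower n t); apply: mule_gt0.
  exact: epoch_cdf_gt0.
by rewrite sojourn_gt ?ltW// lte_fin expR_gt0.
Qed.

Lemma epoch_cdf_fin_num n t : epoch_cdf n t \is a fin_num.
Proof. by rewrite fin_num_measure//; exact: mepoch. Qed.

Lemma epoch_cdf_lt0 n t : t < 0 -> epoch_cdf n t = 0%E.
Proof.
move=> t0; apply: subset_measure0 (epoch_lt0 n); try exact: mepoch.
by move=> w /=; rewrite !in_itv/= => /le_lt_trans; apply.
Qed.

Lemma epoch_cdf_0 t : 0 <= t -> epoch_cdf 0 t = 1%E.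
Proof.
move=> t0; rewrite -(probability_setT P); congr (P _).
by apply/seteqP; split => // w _ /=; rewrite /birth_epoch big_ord0 in_itv.
Qed.

(** S_n <= t forces n independent sojourns to be at most t, each with probability at most 1 - exp(-
    r t). This geometric decay rules out explosion. *)
Lemma epoch_cdf_bound r n t : 0 <= t -> (forall k, rate k <= r) ->
  (epoch_cdf n t <= ((1 - expR (- r * t)) ^+ n)%:E)%E.
Proof.
move=> t0 rate_le; elim: n => [|n IH]; first by rewrite epoch_cdf_0 ?expr0.
apply: le_trans (epoch_cdf_decr n t) _; rewrite exprSr EFinM.
apply: lee_pmul => //; try exact: measure_ge0.
rewrite sojourn_le// lee_fin lerD2l lerN2 ler_expR.
by rewrite ler_wpM2r// lerN2.
Qed.

Lemma epoch_cdf_cvg0 r t : 0 <= t -> (forall k, rate k <= r) ->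
  epoch_cdf n t @[n --> \oo] --> 0%E.
Proof.
move=> t0 rate_le.
apply: (@squeeze_cvge _ _ _ _ (fun=> 0%E) _
   (fun n => ((1 - expR (- r * t)) ^+ n)%:E)).
- by apply: nearW => n; rewrite measure_ge0 epoch_cdf_bound.
- exact: cvg_cst.
- apply: cvg_EFin; first exact: nearW.
  apply: cvg_expr; rewrite ger0_norm ?gtrBl ?expR_gt0// subr_ge0 expR_le1.
  by rewrite mulNr oppr_le0 mulr_ge0// (le_trans _ (rate_le 0%N))// ltW.
Qed.

Lemma partial_sum_births_eq t n : 0 <= t ->
  (\sum_(0 <= k < n) P (births_eq tau t k) = 1 - epoch_cdf n t)%E.
Proof.
move=> t0; elim: n => [|n IH]; first by rewrite big_geq// epoch_cdf_0// subee.
rewrite big_nat_recr//= IH (epoch_cdf_births t n).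
have Qfin : P (births_eq tau t n) \is a fin_num.
  by rewrite fin_num_measure//; exact: measurable_births_eq.
rewrite -(fineK Qfin) -(fineK (epoch_cdf_fin_num n.+1 t)).
by rewrite -!(EFinD, EFinN); congr (_%:E); ring.
Qed.

Lemma sum_births_eq r t : 0 <= t -> (forall k, rate k <= r) ->
  (\sum_(0 <= n <oo) P (births_eq tau t n) = 1)%E.
Proof.
move=> t0 rate_le; apply/cvg_lim => //.
have -> : (fun n => \sum_(0 <= k < n) P (births_eq tau t k))%E =
    (fun n => 1 - epoch_cdf n t)%E.
  by apply/funext => n; exact: partial_sum_births_eq.
rewrite -[X in _ --> X](sube0 1); apply: cvgeB => //.
  exact: cvg_cst.
exact: epoch_cdf_cvg0 rate_le.
Qed.

End pure_birth.

(** * Densities of the birth epochs *)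

Lemma measurable_le_indicator (R : realType) (d : measure_display)
    (T : measurableType d) (f g : T -> R) :
  measurable_fun setT f -> measurable_fun setT g ->
  measurable_fun setT (fun x => (f x <= g x)%R%:R : R).
Proof.
move=> mf mg; rewrite (_ : (fun _ => _) =
    fun x => if (f x <= g x)%R then 1 else 0 :> R).
  by apply: measurable_fun_ifT => //; exact: measurable_fun_ler.
by apply/funext => x; case: ifP.
Qed.

Lemma integral_exponential_shift (R : realType) (r x t : R) : x <= t ->
  (\int[lebesgue_measure]_(s in `[x, t]) (r * expR (- r * (s - x)))%:E =
   (1 - expR (- r * (t - x)))%:E)%E.
Proof.
rewrite le_eqVlt => /predU1P[->|xt].
  by rewrite set_itv1 integral_set1 subrr mulr0 expR0 subrr.
pose F (s : R) := - expR (- r * (s - x)).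
have dF (s : R) : is_derive s (1 : R) F (r * expR (- r * (s - x))).
  rewrite /F; apply: is_derive_eq.
  by rewrite /GRing.scale/=; ring.
have cF : continuous F.
  move=> s; apply: differentiable_continuous; apply/derivable1_diffP.
  exact: ex_derive.
have cf : continuous (fun s => r * expR (- r * (s - x))).
  move=> s; apply: differentiable_continuous; apply/derivable1_diffP.
  exact: ex_derive.
rewrite (@continuous_FTC2 _ _ F)//.
- by rewrite /F subrr mulr0 expR0 -EFinB; congr (_%:E); ring.
- exact: continuous_subspaceT.
- split; first by move=> s _; exact: ex_derive.
  + exact/cvg_at_right_filter/cF.
  + exact/cvg_at_left_filter/cF.
- by move=> s _; rewrite derive1E; exact: derive_val.
Qed.

Section birth_epoch_density.
Context (d : measure_display) (T : measurableType d) (R : realType)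
  (P : probability T R) (rate : nat -> R) (tau : nat -> {RV P >-> R}).
Hypothesis rate_gt0 : forall n, 0 < rate n.
Hypothesis htau : birth_process_times rate tau.

(** Given S_n = x, the event requires x <= s and a sojourn longer than s - x. The indicator is a
    real factor so that Tonelli applies on the whole plane. *)
Lemma births_eq_density n s : P (births_eq tau s n) =
  (\int[distribution P (birth_epoch tau n)]_x
    ((x <= s)%R%:R * expR (- rate n * (s - x)))%:E)%E.
Proof.
pose C : set (R * R) := [set xy | xy.1 <= s < xy.1 + xy.2].
have mC : measurable C.
  rewrite [C](_ : _ = [set xy | xy.1 <= s] `&` [set xy | s < xy.1 + xy.2]).
    apply: measurableI; rewrite -[X in measurable X]setTI.
      by apply: measurable_fun_ler.
    by apply: measurable_fun_ltr => //; exact: measurable_funD.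
  by apply/seteqP; split => xy /=; [move=> /andP|move=> /andP].
have -> : births_eq tau s n = epoch_and_sojourn tau n @^-1` C.
  by apply/seteqP; split => w; rewrite /births_eq /C /= birth_epochS.
rewrite epoch_sojourn_law//; last exact: htau.1.
apply: eq_integral => x _.
have [xs|sx] := leP x s; last first.
  rewrite mul0r (_ : xsection C x = set0) ?measure0//.
  apply/seteqP; split => // y; rewrite /xsection /= inE /C /=.
  by rewrite leNgt sx.
rewrite mul1r -(sojourn_gt htau) ?subr_ge0//; congr (P (_ @^-1` _)).
apply/seteqP; split => y; rewrite /xsection /= inE /C /= xs /= in_itv/= andbT.
  by rewrite ltrBlDl.
by rewrite ltrBlDl.
Qed.

Lemma epoch_cdf_convolution n t : epoch_cdf tau n.+1 t =
  (\int[distribution P (birth_epoch tau n)]_x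
    ((x <= t)%R%:R * (1 - expR (- rate n * (t - x))))%:E)%E.
Proof.
pose C : set (R * R) := [set xy | xy.1 + xy.2 <= t].
have mC : measurable C.
  rewrite -[C]setTI; apply: measurable_fun_ler => //; exact: measurable_funD.
rewrite /epoch_cdf.
have -> : birth_epoch tau n.+1 @^-1` `]-oo, t] =
    epoch_and_sojourn tau n @^-1` C.
  by apply/seteqP; split => w; rewrite /C /= in_itv/= birth_epochS.
rewrite epoch_sojourn_law//; last exact: htau.1.
apply: eq_integral => x _.
have -> : xsection C x = `]-oo, t - x]%classic.
  apply/seteqP; split => y; rewrite /xsection /= inE /C /= in_itv/=;
    by rewrite lerBrDl.
have [xt|tx] := leP x t.
  by rewrite mul1r; apply: (sojourn_le htau); rewrite subr_ge0.
by rewrite mul0r; apply: (sojourn_le_lt0 htau); rewrite subr_lt0.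
Qed.

Lemma epoch_cdf_integral n t : epoch_cdf tau n.+1 t =
  (\int[lebesgue_measure]_(s in `]-oo, t])
     ((rate n)%:E * P (births_eq tau s n)))%E.
Proof.
rewrite epoch_cdf_convolution.
(* Given S_n = x, [f] is the density at s of S_{n+1}, cut off at t. Integrating over s first gives
   the convolution; integrating over x first gives rate_n P(N(s) = n). *)
pose f (xs : R * R) : \bar R := ((xs.1 <= xs.2)%R%:R * (xs.2 <= t)%R%:R *
  (rate n * expR (- rate n * (xs.2 - xs.1))))%:E.
have f_ge0 xs : (0 <= f xs)%E.
  by rewrite lee_fin !mulr_ge0 ?ler0n ?expR_ge0// ltW.
have mf : measurable_fun setT f.
  apply/measurable_EFinP; apply: measurable_funM; first apply: measurable_funM.
  - exact: (measurable_le_indicator measurable_fst measurable_snd).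
  - exact: (measurable_le_indicator measurable_snd (measurable_cst t)).
  - apply: measurable_funM => //; apply: measurableT_comp => //.
    by apply: measurable_funM => //; apply: measurable_funB.
transitivity (\int[distribution P (birth_epoch tau n)]_x
    \int[lebesgue_measure]_s f (x, s))%E.
  apply: eq_integral => x _; rewrite /f /=.
  have [xt|tx] := leP x t; last first.
    rewrite mul0r integral0_eq// => s _.
    have [xs|] := leP x s; last by rewrite !mul0r.
    by rewrite leNgt (lt_le_trans tx xs) mulr0 mul0r.
  rewrite mul1r -integral_exponential_shift// [LHS]integral_mkcond.
  apply: eq_integral => s _; rewrite patchE.
  case: ifPn => [|/negP]; rewrite inE/= in_itv/=.
    by move=> /andP[-> ->]; rewrite !mul1r.
  by move=> /negP; rewrite negb_and => /orP[] /negbTE ->; rewrite ?mulr0 !mul0r.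
rewrite fubini_tonelli// [RHS]integral_mkcond; apply: eq_integral => s _.
rewrite patchE births_eq_density /f/=.
case: ifPn => [|/negP]; rewrite inE/= in_itv/=.
  move=> st; rewrite st -ge0_integralZl//=.
  - by apply: eq_integral => x _; rewrite mulr1 -EFinM mulrCA.
  - apply/measurable_EFinP; apply: measurable_funM.
      exact: (measurable_le_indicator (@measurable_id _ _ setT)
        (measurable_cst s)).
    apply: measurableT_comp => //; apply: measurable_funM => //.
    exact: measurable_funB.
  - by rewrite lee_fin ltW.
by move=> /negP/negbTE ->; rewrite integral0_eq// => x _; rewrite mulr0 mul0r.
Qed.

End birth_epoch_density.

(** * Mean number of births by a fixed time *)

Lemma tail_sum_nneseries (R : realType) (q : nat -> \bar R) :
  (forall n, 0 <= q n)%E ->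
  (\sum_(0 <= n <oo) n%:R%:E * q n =
   \sum_(0 <= k <oo) \sum_(k.+1 <= n <oo) q n)%E.
Proof.
(* Each n q_n is q_n summed over k < n; summing this triangular array over n first produces the
   tails. *)
move=> q0; pose a k n : \bar R := if (k < n)%N then q n else 0%E.
have a0 k n : (0 <= a k n)%E by rewrite /a; case: ifP.
transitivity (\sum_(0 <= n <oo) \sum_(0 <= k <oo) a k n)%E.
  apply: eq_eseriesr => n _; rewrite (nneseries_split 0 n)// add0n.
  rewrite [X in (_ + X)%E]eseries0 ?adde0; last first.
    by move=> k nk _; rewrite /a ltnNge nk.
  rewrite (eq_big_nat _ _ (F2 := fun=> q n)); last first.
    by move=> k /andP[_ kn]; rewrite /a kn.
  have sum_const (x : \bar R) m : (m%:R%:E * x = \sum_(0 <= k < m) x)%E.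
    elim: m => [|m IH]; first by rewrite big_geq// mul0e.
    rewrite big_nat_recr//= -IH -natr1 EFinD ge0_muleDl ?lee_fin//.
    by rewrite mul1e.
  exact: sum_const.
rewrite nneseries_interchange//; apply: eq_eseriesr => k _.
rewrite (nneseries_split 0 k.+1)// add0n big_nat_cond big1 ?add0e; last first.
  by move=> n /andP[/andP[_ nk] _]; rewrite /a ltnNge -ltnS nk.
rewrite [LHS]eseries_cond [RHS]eseries_cond; apply: eq_eseriesr => n.
by move=> /andP[_ kn]; rewrite /a kn.
Qed.


Section birth_counts.
Context (d : measure_display) (T : measurableType d) (R : realType)
  (P : probability T R) (l lp : R) (tau : nat -> {RV P >-> R}).
Hypotheses (l_gt0 : 0 < l) (lp_gt0 : 0 < lp).
Hypothesis htau : birth_process_times (birth_rate l lp) tau.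

Let rate_gt0 n : 0 < birth_rate l lp n. Proof. by case: n. Qed.
Let rate_le n : birth_rate l lp n <= Num.max l lp.
Proof. by case: n => [|n] /=; rewrite le_max lexx ?orbT. Qed.

Lemma measurable_prob_births_eq n :
  measurable_fun setT (fun s => P (births_eq tau s n)).
Proof.
apply: (eq_measurable_fun
  (fun s => epoch_cdf tau n s - epoch_cdf tau n.+1 s)%E).
  move=> s _; rewrite (epoch_cdf_births htau s n) addeK//.
  exact: epoch_cdf_fin_num.
by apply: emeasurable_funB; exact: (cdf_measurable (birth_epoch tau _)).
Qed.

Lemma prob_births_eq_lt0 s n : s < 0 -> P (births_eq tau s n) = 0%E.
Proof.
move=> s0; apply/eqP; rewrite eq_le measure_ge0 andbT.
rewrite -(epoch_cdf_lt0 htau n s0) (epoch_cdf_births htau s n).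
by rewrite leeDl// measure_ge0.
Qed.

Lemma prob_births_eq0 s : 0 <= s -> P (births_eq tau s 0) = (expR (- l * s))%:E.
Proof.
move=> s0; rewrite -(sojourn_gt htau 0 s0); congr (P _).
apply/seteqP; split => w; rewrite /births_eq /= in_itv/= andbT
  /birth_epoch big_ord0 big_ord1.
  by move=> /andP[].
by rewrite s0.
Qed.

Lemma tail_births_eq t k : 0 <= t ->
  (\sum_(k.+1 <= n <oo) P (births_eq tau t n) = epoch_cdf tau k.+1 t)%E.
Proof.
move=> t0; have := sum_births_eq rate_gt0 htau t0 rate_le.
rewrite (nneseries_split 0 k.+1); last by move=> *; exact: measure_ge0.
rewrite add0n (partial_sum_births_eq htau)//.
rewrite -(fineK (epoch_cdf_fin_num tau k.+1 t)) -EFinB.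
case: (\sum_(_ <= _ <oo) _)%E => [x| |]//; rewrite -EFinD => -[] x1.
by congr (_%:E); lra.
Qed.

(** The integrand is the mean birth rate at time s: [l] while still in state 0, of probability exp(-
    l s), and [lp] afterwards. *)
Lemma integral_birth_intensity (t : R) : 0 <= t ->
  (\int[lebesgue_measure]_(s in `[0%R, t])
     (l * expR (- l * s) + lp * (1 - expR (- l * s)))%:E =
   ((1 - lp / l) * (1 - expR (- l * t)) + lp * t)%:E)%E.
Proof.
rewrite le_eqVlt => /predU1P[<-|t0].
  by rewrite set_itv1 integral_set1 !mulr0 expR0 subrr mulr0 addr0.
pose F (s : R) := (1 - lp / l) * (1 - expR (- l * s)) + lp * s.
have dF (s : R) : is_derive s (1 : R) F
    (l * expR (- l * s) + lp * (1 - expR (- l * s))).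
  rewrite /F; apply: is_derive_eq.
  by rewrite /GRing.scale/=; field; rewrite gt_eqF.
have cF : continuous F.
  move=> s; apply: differentiable_continuous; apply/derivable1_diffP.
  exact: ex_derive.
rewrite (@continuous_FTC2 _ _ F)//.
- by rewrite /F !mulr0 expR0 -EFinB; congr (_%:E); ring.
- apply: continuous_subspaceT => s.
  by apply: differentiable_continuous; apply/derivable1_diffP; exact: ex_derive.
- split; first by move=> s _; exact: ex_derive.
  + exact/cvg_at_right_filter/cF.
  + exact/cvg_at_left_filter/cF.
- by move=> s _; rewrite derive1E; exact: derive_val.
Qed.

Lemma sum_epoch_cdf t : 0 <= t ->
  (\sum_(0 <= n <oo) epoch_cdf tau n.+1 t =
   ((1 - lp / l) * (1 - expR (- l * t)) + lp * t)%:E)%E.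
Proof.
move=> t0; rewrite -integral_birth_intensity//.
under eq_eseriesr do rewrite (epoch_cdf_integral rate_gt0 htau).
rewrite -integral_nneseries//; last 2 first.
- move=> n; apply: measurable_funTS; apply: measurable_funeM.
  exact: measurable_prob_births_eq.
- by move=> n s _; rewrite mule_ge0 ?lee_fin ?measure_ge0// ltW.
rewrite integral_mkcond [RHS]integral_mkcond; apply: eq_integral => s _.
rewrite !patchE.
case: ifPn => [|/negP]; rewrite inE/= in_itv/= => st; last first.
  case: ifPn => //; rewrite inE/= in_itv/= => /andP[_ ?]; by case: st.
(* Negative times contribute nothing, so the half-line reduces to [0, t]. *)
have [s0|s0] := leP 0 s; last first.
  rewrite eseries0; last by move=> n _ _; rewrite prob_births_eq_lt0// mule0.
  by case: ifPn => //; rewrite inE/= in_itv/= leNgt s0.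
rewrite mem_set/=; last by rewrite in_itv/= s0.
rewrite nneseries_recl//; last first.
  by move=> n _; rewrite mule_ge0 ?lee_fin ?measure_ge0// ltW.
rewrite prob_births_eq0// -EFinM EFinD; congr (_ + _)%E.
rewrite -nneseries_addn; last first.
  by move=> n; rewrite mule_ge0 ?lee_fin ?measure_ge0// ltW.
under eq_eseriesr do rewrite addn1/=.
rewrite nneseriesZl; last by move=> n _; exact: measure_ge0.
rewrite EFinM; congr (_ * _)%E.
(* All states from 1 on share the rate [lp], and their total probability is 1 - exp(- l s) by
   non-explosion. *)
have S1 : (P (births_eq tau s 0) +
    \sum_(1 <= n <oo) P (births_eq tau s n) = 1)%E.
  rewrite -[RHS](sum_births_eq rate_gt0 htau s0 rate_le).
  by rewrite [RHS]nneseries_recl// => n _; exact: measure_ge0.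
move: S1; rewrite -(@nneseries_addn _ _ 1); last first.
  by move=> n; exact: measure_ge0.
under eq_eseriesr do rewrite addn1/=.
by rewrite prob_births_eq0// EFinB => <-; rewrite [X in (X - _)%E]addeC addeK.
Qed.

Lemma mean_births_eq t : 0 <= t ->
  (\sum_(0 <= n <oo) n%:R%:E * P (births_eq tau t n) =
   ((1 - lp / l) * (1 - expR (- l * t)) + lp * t)%:E)%E.
Proof.
move=> t0; rewrite tail_sum_nneseries; last by move=> n; exact: measure_ge0.
by under eq_eseriesr do rewrite tail_births_eq//; exact: sum_epoch_cdf.
Qed.

End birth_counts.

(** * Arrivals during a service *)

Section densities.
Variables (R : realType) (f : R -> R).
Hypothesis hf : is_density f.
Local Notation D := (`[0, +oo[%classic : set R).
Local Notation mu := (@lebesgue_measure R).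

Let f_ge0 t : D t -> 0 <= f t.
Proof. by case: hf => _ + _; rewrite /= in_itv/= andbT; exact. Qed.
Let mf : measurable_fun D f. Proof. by case: hf. Qed.
Let intf : (\int[mu]_(t in D) (f t)%:E = 1)%E. Proof. by case: hf. Qed.

Lemma density_integrable : mu.-integrable D (EFin \o f).
Proof.
apply/integrableP; split; first exact/measurable_EFinP.
apply: le_lt_trans (ltry 1); rewrite -intf le_eqVlt; apply/orP; left; apply/eqP.
by apply: eq_integral => t; rewrite inE => Dt /=; rewrite ger0_norm// f_ge0.
Qed.

Lemma bounded_density_integrable (g : R -> R) : measurable_fun D g ->
  (forall t, D t -> 0 <= g t <= 1) ->
  mu.-integrable D (EFin \o (fun t => g t * f t)).
Proof.
move=> mg g01; apply: le_integrable density_integrable => //.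
  by apply/measurable_EFinP; apply: measurable_funM.
move=> t Dt /=; rewrite lee_fin normrM ler_piMl//.
by have /andP[g0 g1] := g01 t Dt; rewrite ger0_norm.
Qed.

Lemma mean_integrable : (mean f < +oo)%E ->
  mu.-integrable D (EFin \o (fun t => t * f t)).
Proof.
move=> fmean; apply/integrableP; split.
  by apply/measurable_EFinP; apply: measurable_funM.
apply: le_lt_trans fmean; rewrite le_eqVlt; apply/orP; left; apply/eqP.
apply: eq_integral => t; rewrite inE => tD /=.
move: (tD); rewrite /= in_itv/= andbT => t0.
by rewrite ger0_norm// mulr_ge0// f_ge0.
Qed.

(** If the integral vanished, g f would be 0 almost everywhere, hence f too, against its total mass
    1. Positivity of g is asked only for t > 0, since 1 - exp(- s t) and P(N(t) = n) with n >= 1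
    vanish at 0. *)
Lemma integral_density_gt0 (g : R -> R) : measurable_fun D g ->
  (forall t, D t -> 0 <= g t) -> (forall t, 0 < t -> 0 < g t) ->
  (0 < \int[mu]_(t in D) (g t * f t)%:E)%E.
Proof.
move=> mg g0 gpos; rewrite lt_neqAle integral_ge0 ?andbT; last first.
  by move=> t Dt; rewrite lee_fin mulr_ge0 ?g0 ?f_ge0.
apply/negP => /eqP I0.
have mgf : measurable_fun D (fun t => (g t * f t)%:E).
  by apply/measurable_EFinP; exact: measurable_funM.
have : ae_eq mu D (fun t => (g t * f t)%:E) (cst 0%E).
  apply/ae_eq_integral_abs => //; rewrite I0; apply: eq_integral => t.
  by rewrite inE => Dt; rewrite gee0_abs// lee_fin mulr_ge0 ?g0 ?f_ge0.
move=> gf0; have f0 : ae_eq mu D (EFin \o f) (cst 0%E).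
  have tne0 : {ae mu, forall t : R, t != 0}.
    exists [set 0]; split => //; first exact: lebesgue_measure_set1.
    by move=> t /= /negP; rewrite negbK => /eqP.
  apply: filterS2 gf0 tne0 => t gft t_neq0 Dt.
  have t0 : 0 < t.
    by move: Dt; rewrite /= in_itv/= andbT lt_neqAle eq_sym t_neq0.
  have := gft Dt; rewrite /= => -[] /eqP; rewrite mulf_eq0 gt_eqF ?gpos//=.
  by move=> /eqP ->.
have := intf; rewrite (ae_eq_integral _ _ _ _ _ f0)//; last first.
  exact/measurable_EFinP.
by rewrite integral0 => -[] /eqP; rewrite eq_sym oner_eq0.
Qed.

Let mexp s : measurable_fun D (fun t : R => expR (- s * t)).
Proof. by apply: measurableT_comp => //; apply: measurable_funM. Qed.

Let exp01 s t : 0 < s -> D t -> 0 <= expR (- s * t) <= 1.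
Proof.
rewrite /= in_itv/= andbT => s0 t0.
by rewrite expR_ge0 expR_le1 mulNr oppr_le0 mulr_ge0// ltW.
Qed.

Lemma LST_integrable s : 0 < s ->
  mu.-integrable D (EFin \o (fun t => expR (- s * t) * f t)).
Proof.
by move=> s0; apply: bounded_density_integrable => // t; exact: exp01.
Qed.

Lemma LSTE s : 0 < s ->
  (LST f s)%:E = (\int[mu]_(t in D) (expR (- s * t) * f t)%:E)%E.
Proof.
move=> s0; rewrite /LST /Rintegral fineK//; apply: integrable_fin_num => //.
exact: LST_integrable.
Qed.

Lemma LST_gt0 s : 0 < s -> 0 < LST f s.
Proof.
move=> s0; rewrite -lte_fin LSTE//; apply: integral_density_gt0 => // t _.
exact: expR_gt0.
Qed.

Lemma Rintegral_density : \int[mu]_(t in D) f t = 1.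
Proof. by rewrite /Rintegral intf. Qed.

Lemma LST_lt1 s : 0 < s -> LST f s < 1.
Proof.
move=> s0; rewrite -subr_gt0 -lte_fin.
have -> : (1 - LST f s)%:E =
    (\int[mu]_(t in D) ((1 - expR (- s * t)) * f t)%:E)%E.
  rewrite -[X in (X - _)%:E]Rintegral_density -RintegralB//; last 2 first.
  - exact: density_integrable.
  - exact: LST_integrable.
  rewrite /Rintegral fineK.
    by apply: eq_integral => t _; rewrite mulrBl mul1r.
  apply: integrable_fin_num => //.
  exact: (integrableB _ density_integrable (LST_integrable s0)).
apply: integral_density_gt0.
- by apply: measurable_funB.
- by move=> t /(exp01 s0)/andP[_]; rewrite subr_ge0.
- by move=> t t0; rewrite subr_gt0 expR_lt1 mulNr oppr_lt0 mulr_gt0.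
Qed.

End densities.

(** * Positivity, total mass and mean of the arrival law *)

Section arrivals.
Context (d : measure_display) (T : measurableType d) (R : realType)
  (P : probability T R) (l lp : R) (tau : nat -> {RV P >-> R}) (b : R -> R).
Hypotheses (l_gt0 : 0 < l) (lp_gt0 : 0 < lp).
Hypothesis htau : birth_process_times (birth_rate l lp) tau.
Hypotheses (hb : is_density b) (bmean : (mean b < +oo)%E).
Local Notation D := (`[0, +oo[%classic : set R).
Local Notation mu := (@lebesgue_measure R).
Let q n t : R := fine (P (births_eq tau t n)).

Let qE n t : (q n t)%:E = P (births_eq tau t n).
Proof.
by rewrite /q fineK// fin_num_measure//; exact: measurable_births_eq.
Qed.

Let q_ge0 n t : 0 <= q n t. Proof. by rewrite -lee_fin qE measure_ge0. Qed.

Let mq n : measurable_fun D (q n).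
Proof.
apply: measurable_funTS; apply/measurable_EFinP.
apply: eq_measurable_fun (measurable_prob_births_eq htau n) => t _.
exact/esym/qE.
Qed.

Let b_ge0 t : D t -> 0 <= b t.
Proof. by case: hb => _ + _; rewrite /= in_itv/= andbT; exact. Qed.

Let D_ge0 t : D t -> 0 <= t. Proof. by rewrite /= in_itv/= andbT. Qed.

Let mqb n : measurable_fun D (fun t => (q n t * b t)%:E).
Proof. by apply/measurable_EFinP; apply: measurable_funM => //; case: hb. Qed.

Let qb_ge0 n t : D t -> (0 <= (q n t * b t)%:E)%E.
Proof. by move=> Dt; rewrite lee_fin mulr_ge0 ?q_ge0 ?b_ge0. Qed.

Lemma arrivals_probE n : (arrivals_prob tau b n)%:E =
  (\int[mu]_(t in D) (q n t * b t)%:E)%E.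
Proof.
rewrite /arrivals_prob /Rintegral fineK//; apply: integrable_fin_num => //.
apply: (bounded_density_integrable hb (mq n)) => t _; rewrite q_ge0 -lee_fin qE.
by apply: probability_le1; exact: measurable_births_eq.
Qed.

Lemma arrivals_prob_gt0 n : 0 < arrivals_prob tau b n.
Proof.
rewrite -lte_fin arrivals_probE; apply: integral_density_gt0 => // [t t0].
rewrite -lte_fin qE; apply: births_eq_gt0 htau _ _ t0.
by case=> [|k].
Qed.

Lemma arrivals_prob_sum : (\sum_(0 <= n <oo) (arrivals_prob tau b n)%:E = 1)%E.
Proof.
under eq_eseriesr do rewrite arrivals_probE.
rewrite -integral_nneseries//.
case: (hb) => _ _ <-; apply: eq_integral => t; rewrite inE => Dt.
transitivity (\sum_(0 <= n <oo) ((b t)%:E * P (births_eq tau t n)))%E.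
  by apply: eq_eseriesr => n _; rewrite -qE -EFinM mulrC.
rewrite nneseriesZl; last by move=> n _; exact: measure_ge0.
rewrite (sum_births_eq (r := Num.max l lp) _ htau) ?mule1 ?D_ge0//.
  by case.
by case=> [|k] /=; rewrite le_max lexx ?orbT.
Qed.

Lemma arrivals_prob_mean :
  (\sum_(0 <= n <oo) (n%:R * arrivals_prob tau b n)%:E =
   ((1 - lp / l) * (1 - LST b l) + lp * fine (mean b))%:E)%E.
Proof.
transitivity (\sum_(0 <= n <oo)
  \int[mu]_(t in D) (n%:R%:E * (q n t * b t)%:E))%E.
  apply: eq_eseriesr => n _; rewrite EFinM arrivals_probE ge0_integralZl//.
  - exact: mqb.
  - by move=> t; exact: qb_ge0.
rewrite -integral_nneseries//; last 2 first.
- by move=> n; apply: measurable_funeM; exact: mqb.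
- by move=> n t Dt; apply: mule_ge0; [rewrite lee_fin|exact: qb_ge0].
(* [g] is the mean number of births by time t weighted by b t, arranged so that its integral splits
   into the transform and the mean of b. *)
pose g t := (1 - lp / l) * (b t - expR (- l * t) * b t) + lp * (t * b t).
have ib := density_integrable hb.
have ie := LST_integrable hb l_gt0.
have it := mean_integrable hb bmean.
have meanE : fine (mean b) = \int[mu]_(t in D) (t * b t) by [].
have iB : mu.-integrable D (EFin \o (fun t => b t - expR (- l * t) * b t)).
  exact: (integrableB _ ib ie).
have iZ : mu.-integrable D
    (EFin \o (fun t => (1 - lp / l) * (b t - expR (- l * t) * b t))).
  exact: (integrableZl _ (1 - lp / l) iB).
have iL : mu.-integrable D (EFin \o (fun t => lp * (t * b t))).
  exact: (integrableZl _ lp it).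
transitivity (\int[mu]_(t in D) (g t)%:E)%E; last first.
  have -> : 1 - LST b l = \int[mu]_(t in D) (b t - expR (- l * t) * b t).
    by rewrite RintegralB// (Rintegral_density hb).
  rewrite meanE -RintegralZl// -RintegralZl// -RintegralD//.
  rewrite /Rintegral fineK//; apply: integrable_fin_num => //.
  exact: (integrableD _ iZ iL).
apply: eq_integral => t; rewrite inE => Dt.
transitivity ((b t)%:E * \sum_(0 <= n <oo) (n%:R%:E * P (births_eq tau t n)))%E.
  rewrite -nneseriesZl; last first.
    by move=> n _; rewrite mule_ge0 ?lee_fin ?measure_ge0.
  by apply: eq_eseriesr => n _; rewrite -qE -!EFinM; congr (_%:E); ring.
rewrite (mean_births_eq l_gt0 lp_gt0 htau) ?D_ge0//.
by rewrite -EFinM /g; congr (_%:E); ring.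
Qed.

End arrivals.

(** * The orbit chain *)

Section orbit_chain_ergodicity.
Variables (R : realType) (al : R) (be br : nat -> R) (me mr : R).
Hypotheses (al_gt0 : 0 < al) (al_lt1 : al < 1).
Hypotheses (be_gt0 : forall n, 0 < be n) (br_gt0 : forall n, 0 < br n).
Hypothesis be_sum : (\sum_(0 <= n <oo) (be n)%:E = 1)%E.
Hypothesis br_sum : (\sum_(0 <= n <oo) (br n)%:E = 1)%E.
Hypothesis be_mean : (\sum_(0 <= n <oo) (n%:R * be n)%:E = me%:E)%E.
Hypothesis br_mean : (\sum_(0 <= n <oo) (n%:R * br n)%:E = mr%:E)%E.

(* [orbit_step j] is the probability of moving from m + 1 to m + j. *)
Definition orbit_step (j : nat) : R :=
  if j is j'.+1 then (1 - al) * be j' + al * br j'.+1 else al * br 0%N.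

Let al1_gt0 : 0 < 1 - al. Proof. by rewrite subr_gt0. Qed.

Lemma orbit_chainE : orbit_chain al be br = skip_free_chain be orbit_step.
Proof.
apply/funext => -[|m]; apply/funext => n; rewrite /orbit_chain //=.
case: (ltngtP m n) => [mn|nm|->].
- by rewrite -(subnSK mn) /= addn1.
- by rewrite eqSS gtn_eqF.
- by rewrite eqxx subnn.
Qed.

Lemma orbit_step_gt0 j : 0 < orbit_step j.
Proof. by case: j => [|j] /=; rewrite ?addr_gt0 ?mulr_gt0. Qed.

Let series_recl (u : nat -> R) : (forall n, 0 <= u n) ->
  (\sum_(0 <= n <oo) (u n)%:E = (u 0%N)%:E + \sum_(0 <= n <oo) (u n.+1)%:E)%E.
Proof.
move=> u0; rewrite nneseries_recl//; last by move=> n _; rewrite lee_fin.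
congr (_ + _)%E; rewrite -nneseries_addn; last by move=> n; rewrite lee_fin.
by apply: eq_eseriesr => n _; rewrite addn1.
Qed.

Let series_lin (x y : R) (u v : nat -> R) : 0 <= x -> 0 <= y ->
  (forall n, 0 <= u n) -> (forall n, 0 <= v n) ->
  (\sum_(0 <= n <oo) (x * u n + y * v n)%:E =
   x%:E * \sum_(0 <= n <oo) (u n)%:E + y%:E * \sum_(0 <= n <oo) (v n)%:E)%E.
Proof.
move=> x0 y0 u0 v0; rewrite -nneseriesZl; last by move=> n _; rewrite lee_fin.
rewrite -nneseriesZl; last by move=> n _; rewrite lee_fin.
rewrite -nneseriesD.
- by apply: eq_eseriesr => n _; rewrite EFinD !EFinM.
- by move=> n _ _; rewrite -EFinM lee_fin mulr_ge0.
- by move=> n _ _; rewrite -EFinM lee_fin mulr_ge0.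
Qed.

Lemma orbit_step_sum : (\sum_(0 <= j <oo) (orbit_step j)%:E = 1)%E.
Proof.
have brS : (\sum_(0 <= n <oo) (br n.+1)%:E = (1 - br 0%N)%:E)%E.
  have := br_sum; rewrite series_recl; last by move=> n; exact: ltW.
  case: (\sum_(_ <= _ <oo) _)%E => [x| |]//; rewrite -EFinD => -[] <-.
  by congr (_%:E); ring.
rewrite series_recl /=; last by move=> n; rewrite ltW ?orbit_step_gt0.
rewrite series_lin ?be_sum ?brS; try (by move=> *; exact: ltW); try exact: ltW.
by rewrite -!(EFinM, EFinD); congr (_%:E); ring.
Qed.

(** Here j is one plus the increment of the orbit. An external service adds its arrivals, whence me
    + 1; a retrial service also removes one customer, whence mr. *)
Lemma orbit_step_mean : (\sum_(0 <= j <oo) (j%:R * orbit_step j)%:E =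
  ((1 - al) * (me + 1) + al * mr)%:E)%E.
Proof.
have brS : (\sum_(0 <= n <oo) (n.+1%:R * br n.+1)%:E = mr%:E)%E.
  have := br_mean; rewrite (series_recl (u := fun n => n%:R * br n)).
    by rewrite mul0r add0e.
  by move=> n; rewrite mulr_ge0// ltW.
have beS : (\sum_(0 <= n <oo) (n.+1%:R * be n)%:E = (me + 1)%:E)%E.
  rewrite EFinD -be_mean -be_sum -nneseriesD.
  - by apply: eq_eseriesr => n _; rewrite -EFinD -natr1 mulrDl mul1r.
  - by move=> n _ _; rewrite lee_fin mulr_ge0// ltW.
  - by move=> n _ _; rewrite lee_fin ltW.
rewrite (series_recl (u := fun n => n%:R * orbit_step n)); last first.
  by move=> n; rewrite mulr_ge0// ltW ?orbit_step_gt0.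
rewrite mul0r add0e /= [RHS]EFinD EFinM -beS EFinM -brS -series_lin.
- by apply: eq_eseriesr => n _; congr (_%:E); ring.
- exact: ltW.
- exact: ltW.
- by move=> n; rewrite mulr_ge0// ltW.
- by move=> n; rewrite mulr_ge0// ltW.
Qed.

(** The condition amounts to (1 - al) me + al mr < al: the mean number of arrivals per service is
    less than the probability that the service is a retrial. *)
Lemma orbit_chain_ergodic :
  ergodic_chain (orbit_chain al be br) <-> (1 - al) * (me + 1) + al * mr < 1.
Proof.
rewrite orbit_chainE -lte_fin -orbit_step_mean; split=> [[_ _ pr]|drift].
  exact: skip_free_drift be_gt0 orbit_step_gt0 be_sum orbit_step_sum pr.
split.
- exact: skip_free_irreducible be_gt0 orbit_step_gt0.
- exact: skip_free_aperiodic be_gt0 orbit_step_gt0.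
- apply: skip_free_positive_recurrent be_gt0 orbit_step_gt0 be_sum
    orbit_step_sum _ drift.
  by rewrite be_mean ltry.
Qed.

End orbit_chain_ergodicity.

(** * The stability condition in terms of the mean service time *)

Unset Implicit Arguments.

Theorem theorem3p1 (R : realType) (a b : R -> R)
    (lam lam_e lamp_e lam_r lamp_r : R)
    (de dr : measure_display)
    (Omega_e : measurableType de) (Omega_r : measurableType dr)
    (P_e : probability Omega_e R) (P_r : probability Omega_r R)
    (tau_e : nat -> {RV P_e >-> R}) (tau_r : nat -> {RV P_r >-> R})
    (ha : is_density a) (hb : is_density b) (hbmean : (mean b < +oo)%E)
    (hlam : 0 < lam)
    (hlam_e : 0 < lam_e) (hlamp_e : 0 < lamp_e)
    (hlam_r : 0 < lam_r) (hlamp_r : 0 < lamp_r)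
    (htau_e : birth_process_times (birth_rate lam_e lamp_e) tau_e)
    (htau_r : birth_process_times (birth_rate lam_r lamp_r) tau_r) :
  let alpha := LST a lam in
  ergodic_chain
    (orbit_chain alpha (arrivals_prob tau_e b) (arrivals_prob tau_r b))
  <->
  fine (mean b) <
    alpha * (lamp_r + (lam_r - lamp_r) * LST b lam_r)
      / (lam_r * (lamp_e + (lamp_r - lamp_e) * alpha))
    - (1 - alpha) * (lam_e - lamp_e) * (1 - LST b lam_e)
      / (lam_e * (lamp_e + (lamp_r - lamp_e) * alpha)).
Proof.
move=> alpha.
have al_gt0 : 0 < alpha by exact: LST_gt0.
have al_lt1 : alpha < 1 by exact: LST_lt1.
apply: (iff_trans (orbit_chain_ergodic al_gt0 al_lt1
  (arrivals_prob_gt0 hlam_e hlamp_e htau_e hb)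
  (arrivals_prob_gt0 hlam_r hlamp_r htau_r hb)
  (arrivals_prob_sum hlam_e hlamp_e htau_e hb)
  (arrivals_prob_sum hlam_r hlamp_r htau_r hb)
  (arrivals_prob_mean hlam_e hlamp_e htau_e hb hbmean)
  (arrivals_prob_mean hlam_r hlamp_r htau_r hb hbmean))).
(* This common denominator, a convex combination of the two subsequent rates, is also the
   coefficient of the mean service time in the drift. *)
have K_gt0 : 0 < lamp_e + (lamp_r - lamp_e) * alpha.
  have -> : lamp_e + (lamp_r - lamp_e) * alpha =
    lamp_e * (1 - alpha) + lamp_r * alpha by ring.
  by rewrite addr_gt0// mulr_gt0// subr_gt0.
rewrite -subr_gt0 -[X in _ <-> is_true X]subr_gt0.
set gap := (X in is_true (0 < X) <-> _).
set gap' := (X in _ <-> is_true (0 < X)).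
(* Solving the drift condition for the mean service time divides the gap between its sides by this
   positive coefficient. *)
have -> : gap' = gap / (lamp_e + (lamp_r - lamp_e) * alpha).
  by rewrite /gap /gap'; field; rewrite !gt_eqF.
by rewrite pmulr_lgt0 ?invr_gt0.
Qed.
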